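(* Let $Y \neq \{0\}$ be a real Banach space with the Daugavet property. Then there exist two convex closed bounded symmetric subsets of $Y$ which are SCD but whose intersection is not SCD. If $Y$ is separable, then two such sets can be chosen to be bodies, i.e. to have non-empty interior.
   Context: All Banach spaces are real. A set $C$ is symmetric if $-C=C$. For a non-empty bounded set $A \subset Y$, a slice of $A$ is a (non-empty) set of the form $S(A,x^*,\varepsilon)=\{x\in A : x^*(x) > \sup_{a\in A} x^*(a)-\varepsilon\}$ with $x^*\in Y^*\setminus\{0\}$ and $\varepsilon>0$. A sequence $(U_n)_{n\in\mathbb N}$ of non-empty subsets of a bounded set $A\subset Y$ is called determining (for $A$) if for every $B\subset Y$ with $B\cap U_n\neq\emptyset$ for all $n$ one has $A\subset\overline{\mathrm{conv}}(B)$ (norm-closed convex hull). A bounded set $A$ is SCD (slicely countably determined) if it has a determining sequence consisting of slices of $A$. A Banach space $Y$ has the Daugavet property if every bounded linear rank-one operator $T\colon Y\to Y$ satisfies $\|I+T\|=1+\|T\|$. *)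

(* Defs.v *)
From HB Require Import structures.
From mathcomp Require Import all_boot all_order all_algebra.
From mathcomp Require Import all_classical all_reals all_analysis.

Set Implicit Arguments.
Unset Strict Implicit.
Unset Printing Implicit Defensive.

Import Order.TTheory GRing.Theory Num.Theory.
Import numFieldNormedType.Exports.

Local Open Scope classical_set_scope.
Local Open Scope ring_scope.

(* Meaningful for bounded linear [T]: otherwise the supremum may not exist
   and [sup] takes a default value. *)
Definition opnorm (R : realType) (V W : normedModType R) (T : V -> W) : R :=
  sup [set `|T x| | x in [set x : V | `|x| <= 1]].

Definition rank_one (R : realType) (V W : normedModType R)
    (T : {linear V -> W}) : Prop :=
  exists2 w : W, w != 0 & range T = [set a *: w | a in [set: R]].

(* [bounded_near T (nbhs 0)] is boundedness of the linear operator [T], see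
   [linear_boundedP]. *)
Definition daugavet_property (R : realType) (Y : normedModType R) : Prop :=
  forall T : {linear Y -> Y},
    bounded_near T (nbhs (0 : Y)) -> rank_one T ->
    opnorm (fun x => x + T x) = 1 + opnorm T.

Definition symmetric_set (V : zmodType) (C : set V) : Prop :=
  [set - x | x in C] = C.

Definition separable_space (T : topologicalType) : Prop :=
  exists2 D : set T, countable D & dense D.

Definition conv_hull (R : realType) (Y : normedModType R) (B : set Y) : set Y :=
  smallest (@convex_set R Y) B.

Definition slice (R : realType) (Y : normedModType R)
    (A : set Y) (f : Y -> R) (e : R) : set Y :=
  [set x | A x /\ f x > sup (f @` A) - e].

(* Used only for non-empty bounded [A], as imposed in [SCD]: then [f @` A] has
   a supremum and the slices are non-empty. *)
Definition is_slice (R : realType) (Y : normedModType R)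
    (A S : set Y) : Prop :=
  exists (f : {linear Y -> R^o}) (e : R),
    [/\ continuous f, exists x, f x != 0, 0 < e & S = slice A f e].

Definition determining (R : realType) (Y : normedModType R)
    (A : set Y) (U : nat -> set Y) : Prop :=
  (forall n, U n !=set0 /\ U n `<=` A) /\
  forall B : set Y, (forall n, B `&` U n !=set0) ->
    A `<=` closure (conv_hull B).

Definition SCD (R : realType) (Y : normedModType R) (A : set Y) : Prop :=
  [/\ A !=set0, bounded_set A &
      exists U : nat -> set Y, (forall n, is_slice A (U n)) /\ determining A U].

(* Main.v *)
Require Import Defs.
From HB Require Import structures.
From mathcomp Require Import all_boot all_order all_algebra.
From mathcomp Require Import all_classical all_reals all_analysis.
From mathcomp Require Import zify ring lra.

Set Implicit Arguments.
Unset Strict Implicit.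
Unset Printing Implicit Defensive.

Import Order.TTheory GRing.Theory Num.Theory.
Import numFieldNormedType.Exports.

Local Open Scope classical_set_scope.
Local Open Scope ring_scope.

(** The theorem rests on a failure of slices in a Daugavet space: for finitely
    many vectors [y], every slice of the unit ball contains a point [x] with
    [`|x + y|] almost equal to [1 + `|y|] ([octahedral_seq]).  Choosing points
    one after the other in countably many given slices, each almost
    norm-additive with a fixed vector plus the sum of the previous choices, one
    keeps their closed convex hull away from that fixed vector.  So the unit
    ball, and any set whose slices are governed by those of the ball, is not
    slicely countably determined.

    Let [u], [v] span a plane [W], with dual coordinates [phi], [psi], let [d] be
    the distance to [W], and let [Z] be a closed separable subspace with the
    Daugavet property that contains [W].  The intersection of the two sets will
    be [A = {y in Z | d y + max (`|phi y|, `|psi y|) <= 1}], the closed convex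
    hull of the projection of the unit ball of [Z] along [W] and of a square in [W].  A
    slice of [A] meets the square or contains the projection of a slice of the
    ball ([slice_dichotomy]).  A projected point differs from the point itself
    by an element of [W] only, so it suffices to make the choices above almost
    norm-additive uniformly over a bounded box of [W], which is a compactness
    argument ([octahedral_box]); hence [A] is not SCD ([not_SCD]).

    Let [(b n)] be dense in the points of [Z] killed by [phi] and [psi] that have
    [d]-norm [1].  The first set is the closed convex hull of the four corners
    of the square and of the points [(1 - shrink n) *: b n + tilt n *: u] and
    their opposites; the second one uses [v] in place of [u].
    - Since [d + `|psi|] is at most [1] on the generators of the first set and
      [d + `|phi|] on those of the second one, the intersection lies in [A];
      since the tilts and shrinkings vanish at infinity, it contains [A]
      ([tilted_body_le], [tilted_body_ball]).
    - Every generator is strongly exposed ([generator_exposed]).  Take a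
      functional [h <= d] with [h (b n) = 1] and expose the [n]-th point by
      [h + slope n *: phi].  At an earlier point [k < n] the value of [h] is at
      most [1 - shrink k], and [shrink k] outweighs the term
      [slope n * tilt k]; at a later point the term [slope n * tilt k] is at most half of
      [slope n * tilt n = 4 * shrink n].  Hence the [n]-th point wins wherever
      the [b n] are placed.  A set generated by countably many strongly exposed
      points is SCD ([SCD_strongly_exposed]).

    If [Y] is separable, take [Z = Y], and both sets have [0] in their interior.
    In general [Z] is obtained by closing off a countable set
    ([daugavet_separable_subspace]): by separation, each point of the ball is
    close to a convex combination of finitely many points almost norm-additive
    with a given vector. *)

(** * Sublinear functions and the Hahn-Banach theorem *)

Section Sublinear.
Context {R : realType} {V : lmodType R}.
Implicit Types (p q : V -> R) (x y z : V).

Definition sublinear p :=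
  (forall x y, p (x + y) <= p x + p y) /\
  (forall (t : R) x, 0 <= t -> p (t *: x) = t * p x).

Lemma sublinear0 p : sublinear p -> p 0 = 0.
Proof. by case=> _ h; have := h 0 0 (lexx _); rewrite scale0r mul0r. Qed.

Lemma sublinear_lbound p x : sublinear p -> - p (- x) <= p x.
Proof.
move=> sp; have := sp.1 x (- x); rewrite subrr sublinear0//; lra.
Qed.

Definition linear_functional (f : V -> R) :=
  (forall x y, f (x + y) = f x + f y) /\ (forall a x, f (a *: x) = a * f x).

Lemma sublinear_additive_linear p : sublinear p ->
  (forall x y, p x + p y <= p (x + y)) -> linear_functional p.
Proof.
move=> sp hp.
have pD x y : p (x + y) = p x + p y by apply/eqP; rewrite eq_le hp sp.1.
have pN x : p (- x) = - p x.
  by have := pD x (- x); rewrite subrr sublinear0//; lra.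
split=> // a x; have [a0|/ltW a0] := leP 0 a; first exact: sp.2.
have := sp.2 (- a) x; rewrite scaleNr pN oppr_ge0 => /(_ a0); lra.
Qed.

(** When [N] is a convex cone of pairs [(t, z)] with [t <= p z], this is the
    largest sublinear function below [p] that satisfies [q (- z) <= - t] on [N];
    a linear function below it satisfies [t <= g z]. *)
Definition lowering p (N : R -> V -> Prop) x :=
  inf [set r | exists t z, N t z /\ r = p (x + z) - t].

Section Lowering.
Variables (p : V -> R) (N : R -> V -> Prop).
Hypotheses (sp : sublinear p) (N0 : N 0 0)
  (ND : forall (s t : R) y z, N s y -> N t z -> N (s + t) (y + z))
  (NZ : forall (a t : R) z, 0 < a -> N t z -> N (a * t) (a *: z))
  (Np : forall t z, N t z -> t <= p z).

Local Notation S x := [set r | exists t z, N t z /\ r = p (x + z) - t].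

Let S_lb x : lbound (S x) (- p (- x)).
Proof.
move=> _ [t [z [Ntz ->]]]; have := Np Ntz.
have := sp.1 (x + z) (- x); rewrite addrAC subrr add0r; lra.
Qed.

Let S_inf x : has_inf (S x).
Proof.
split; last by exists (- p (- x)); exact: S_lb.
by exists (p x), 0, 0; rewrite addr0 subr0.
Qed.

Lemma lowering_le_at x t z : N t z -> lowering p N x <= p (x + z) - t.
Proof. by move=> Ntz; apply: (ge_inf (S_inf x).2); exists t, z. Qed.

Lemma lowering_le x : lowering p N x <= p x.
Proof. by have := lowering_le_at x N0; rewrite addr0 subr0. Qed.

Lemma lowering_adherent x (e : R) : 0 < e ->
  exists t z, N t z /\ p (x + z) - t < lowering p N x + e.
Proof.
by move=> e0; have [_ [t [z [? ->]]] ?] := inf_adherent e0 (S_inf x); exists t, z.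
Qed.

Let scale_le (a : R) x : 0 < a -> lowering p N (a *: x) <= a * lowering p N x.
Proof.
move=> a0; rewrite -ler_pdivrMl//; apply/ler_addgt0Pr => e e0.
have [t [z [Ntz /ltW h]]] := lowering_adherent x e0.
rewrite ler_pdivrMl// (le_trans (lowering_le_at _ (NZ a0 Ntz)))//.
by rewrite -scalerDr sp.2 ?(ltW a0)// -mulrBr ler_wpM2l// ltW.
Qed.

Lemma lowering_sublinear : sublinear (lowering p N).
Proof.
split=> [x y|a x].
  apply/ler_addgt0Pr => e e0; have e20 : 0 < e / 2 by lra.
  have [s [z [Nsz h]]] := lowering_adherent x e20.
  have [t [w [Ntw k]]] := lowering_adherent y e20.
  apply: (le_trans (lowering_le_at _ (ND Nsz Ntw))).
  by have := sp.1 (x + z) (y + w); rewrite addrACA; lra.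
rewrite le_eqVlt => /predU1P[<-|a0].
  rewrite scale0r mul0r; apply/eqP; rewrite eq_le.
  rewrite (le_trans (lowering_le 0)) ?(sublinear0 sp)//=.
  apply: lb_le_inf; first exact: (S_inf 0).1.
  by have := @S_lb 0; rewrite oppr0 (sublinear0 sp) oppr0.
apply/eqP; rewrite eq_le scale_le//=.
have ia : 0 < a^-1 by rewrite invr_gt0.
rewrite -ler_pdivlMl// (le_trans _ (scale_le _ ia))//.
by rewrite scalerA mulVf ?gt_eqF// scale1r.
Qed.

End Lowering.

Definition ray p y (t : R) z := exists2 s, 0 <= s & t = s * p y /\ z = s *: y.

Lemma lowering_ray p y : sublinear p ->
  [/\ sublinear (lowering p (ray p y)),
      forall x, lowering p (ray p y) x <= p x &
      forall x, lowering p (ray p y) x <= p (x + y) - p y].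
Proof.
move=> sp; set N := ray p y.
have N0 : N 0 0 by exists 0 => //; rewrite mul0r scale0r.
have Np t z : N t z -> t <= p z by move=> [s s0 [-> ->]]; rewrite sp.2.
split.
- apply: lowering_sublinear => //.
    move=> _ _ _ _ [s s0 [-> ->]] [t t0 [-> ->]].
    by exists (s + t); rewrite ?addr_ge0// mulrDl scalerDl.
  move=> a _ _ a0 [s s0 [-> ->]]; exists (a * s); first by rewrite mulr_ge0// ltW.
  by rewrite mulrA scalerA.
- by move=> x; exact: lowering_le.
- move=> x; apply: lowering_le_at => //.
  by exists 1; rewrite // mul1r scale1r.
Qed.

(** Lowering [p] along the ray of [y] gives a sublinear function below [p] which
    at [x] is at most [p (x + y) - p y].  Minimality makes it equal to [p], so
    [p] is superadditive. *)
Lemma minimal_sublinear_linear p : sublinear p ->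
  (forall q, sublinear q -> (forall x, q x <= p x) -> q = p) ->
  linear_functional p.
Proof.
move=> sp pmin; apply: sublinear_additive_linear => // x y.
have [sq qp qy] := lowering_ray y sp.
by have := qy x; rewrite (pmin _ sq qp); lra.
Qed.

(** Zorn's lemma yields a minimal sublinear function below [p]: the pointwise
    infimum of a chain is again sublinear, being bounded below by
    [- p (- x)]. *)
Lemma sublinear_above_linear p : sublinear p ->
  exists2 g : V -> R, linear_functional g & forall x, g x <= p x.
Proof.
move=> sp.
pose T := {q : V -> R | sublinear q /\ forall x, q x <= p x}.
pose ge (s t : T) : bool := `[< forall x, sval t x <= sval s x >].
have p0 : T by exists p.
have [||s t /asboolP st /asboolP ts|A Atot|[q [sq qp]] qmin] := @Zorn T ge.
- by move=> t; exact/asboolP.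
- move=> r s t /asboolP rs /asboolP st; apply/asboolP => x.
  exact: le_trans (st x) (rs x).
- have e : sval s = sval t by apply/funext => x; apply/eqP; rewrite eq_le st ts.
  by case: s t e {st ts} => s sP [t tP] /= e; exact: eq_exist.
- have [[a0 Aa0]|A0] := pselect (A !=set0); last first.
    by exists p0 => s As; case: A0; exists s.
  pose S x := [set sval a x | a in A].
  have Sinf x : has_inf (S x).
    split; first by exists (sval a0 x), a0.
    exists (- p (- x)) => _ [[a [sa ap]] _ <-] /=.
    by have := sublinear_lbound x sa; have := ap (- x); lra.
  pose q x := inf (S x).
  have qle a x : A a -> q x <= sval a x.
    by move=> Aa; apply: (ge_inf (Sinf x).2); exists a.
  have adh x (e : R) : 0 < e -> exists2 a, A a & sval a x < q x + e.
    by move=> e0; have [_ [a Aa <-] ?] := inf_adherent e0 (Sinf x); exists a.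
  have sq : sublinear q.
    split=> [x y|t x t0].
      apply/ler_addgt0Pr => e e0; have e20 : 0 < e / 2 by lra.
      have [a Aa ha] := adh x _ e20; have [b Ab hb] := adh y _ e20.
      have [/asboolP/= ab|/asboolP/= ba] := Atot _ _ Aa Ab.
        by have := qle _ (x + y) Ab; have := (svalP b).1.1 x y; have := ab x; lra.
      by have := qle _ (x + y) Aa; have := (svalP a).1.1 x y; have := ba y; lra.
    move: t0; rewrite le_eqVlt => /predU1P[<-|t0].
      rewrite scale0r mul0r /q (_ : S 0 = [set 0]) ?inf1//.
      apply/seteqP; split=> [_ [a _ <-]|_ ->]; first exact: (sublinear0 (svalP a).1).
      by exists a0 => //; exact: (sublinear0 (svalP a0).1).
    apply/eqP; rewrite eq_le; apply/andP; split.
      rewrite -ler_pdivrMl//; apply/ler_addgt0Pr => e e0.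
      have [a Aa ha] := adh x _ e0; rewrite ler_pdivrMl//.
      rewrite (le_trans (qle _ _ Aa))// (svalP a).1.2 ?(ltW t0)//.
      by rewrite ler_pM2l// ltW.
    apply/ler_addgt0Pr => e e0; have [a Aa ha] := adh (t *: x) _ e0.
    apply/ltW/(le_lt_trans _ ha); rewrite (svalP a).1.2 ?(ltW t0)//.
    by rewrite ler_wpM2l ?qle// ltW.
  have qp x : q x <= p x by rewrite (le_trans (qle _ x Aa0))// (svalP a0).2.
  exists (exist _ q (conj sq qp)) => s As; apply/asboolP => x /=.
  exact: qle.
exists q => //; apply: minimal_sublinear_linear => // r sr rq.
have rp x : r x <= p x by exact: le_trans (rq x) (qp x).
by have /(congr1 sval) := qmin (exist _ r (conj sr rp)) (asboolT rq).
Qed.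

(** The Mazur-Orlicz form of the Hahn-Banach theorem: no subspace has to be
    extended, the constraints are absorbed into the sublinear function. *)
Lemma mazur_orlicz p (N : R -> V -> Prop) : sublinear p -> N 0 0 ->
  (forall s t y z, N s y -> N t z -> N (s + t) (y + z)) ->
  (forall (a t : R) z, 0 < a -> N t z -> N (a * t) (a *: z)) ->
  (forall t z, N t z -> t <= p z) ->
  exists g : V -> R, [/\ linear_functional g, forall x, g x <= p x &
    forall t z, N t z -> t <= g z].
Proof.
move=> sp N0 ND NZ Np.
have [g lg gp] := sublinear_above_linear (lowering_sublinear sp N0 ND NZ Np).
exists g; split=> // [x|t z Ntz].
  exact: le_trans (gp x) (lowering_le sp N0 Np x).
have := gp (- z); have := lowering_le_at sp N0 Np (- z) Ntz.
rewrite addNr (sublinear0 sp) -scaleN1r lg.2; lra.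
Qed.

Lemma hahn_banach p b : sublinear p ->
  exists g : V -> R, [/\ linear_functional g, forall x, g x <= p x & g b = p b].
Proof.
move=> sp.
have [sq qp qb] := lowering_ray b sp.
have [g lg gq] := sublinear_above_linear sq.
have gp x : g x <= p x by exact: le_trans (gq x) (qp x).
exists g; split=> //; apply/eqP; rewrite eq_le gp/=.
have := le_trans (gq (- b)) (qb (- b)).
rewrite addNr (sublinear0 sp) -scaleN1r lg.2; lra.
Qed.

End Sublinear.

(** * Functionals and convex hulls in a normed space *)

Section Functionals.
Context {R : realType} {Y : normedModType R}.
Implicit Types (f g h : Y -> R) (x y z : Y) (A B P : set Y).

Lemma linear_functional0 f : linear_functional f -> f 0 = 0.
Proof. by move=> lf; rewrite -(scale0r (0 : Y)) lf.2 mul0r. Qed.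

Lemma linear_functionalN f x : linear_functional f -> f (- x) = - f x.
Proof. by move=> lf; rewrite -scaleN1r lf.2 mulN1r. Qed.

Lemma linear_functionalB f x y : linear_functional f -> f (x - y) = f x - f y.
Proof. by move=> lf; rewrite lf.1 linear_functionalN. Qed.

Lemma linear_functional_sum f N (x : nat -> Y) : linear_functional f ->
  f (\sum_(k < N) x k) = \sum_(k < N) f (x k).
Proof.
move=> lf; elim: N => [|N IH]; first by rewrite !big_ord0 linear_functional0.
by rewrite !big_ord_recr/= lf.1 IH.
Qed.

Definition bounded_functional f :=
  linear_functional f /\ exists2 K, 0 < K & forall x, `|f x| <= K * `|x|.

Lemma bounded_functional_linear f : bounded_functional f ->
  exists2 F : {linear Y -> R^o}, continuous F & forall x, F x = f x.
Proof.
move=> [lf [K K0 fK]].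
have lin : GRing.linear_for *%R f by move=> a x y; rewrite lf.1 lf.2.
pose m := GRing.isLinear.Build R Y R^o *:%R f lin.
pose F : {linear Y -> R^o} := HB.pack f m.
exists F => //; apply: bounded_linear_continuous; apply/linear_boundedP.
near=> r => x; apply: (le_trans (fK x)); rewrite ler_wpM2r//.
Unshelve. all: by end_near. Qed.

Lemma linear_bounded_functional (F : {linear Y -> R^o}) : continuous F ->
  bounded_functional F.
Proof.
move=> /linear_bounded_continuous/linear_boundedP/pinfty_ex_gt0[K K0 FK].
by split; [split=> *; [rewrite linearD|rewrite linearZ]|exists K].
Qed.

Lemma bounded_functional_comb f g a b :
  bounded_functional f -> bounded_functional g ->
  bounded_functional (fun x => a * f x + b * g x).
Proof.
move=> [lf [K K0 fK]] [lg [L L0 gL]]; split.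
  by split=> *; rewrite ?lf.1 ?lf.2 ?lg.1 ?lg.2; ring.
exists (1 + `|a| * K + `|b| * L).
  have := mulr_ge0 (normr_ge0 a) (ltW K0); have := mulr_ge0 (normr_ge0 b) (ltW L0).
  lra.
move=> x; rewrite (le_trans (ler_normD _ _))// !normrM !mulrDl mul1r.
by rewrite -addrA ler_wpDl// lerD// -mulrA ler_wpM2l.
Qed.

Lemma dominated_functional f : linear_functional f ->
  (forall x, f x <= `|x|) -> forall x, `|f x| <= `|x|.
Proof.
move=> lf fle x; rewrite ler_norml fle andbT lerNl -linear_functionalN//.
by rewrite -(normrN x).
Qed.

Lemma dominated_bounded_functional f : linear_functional f ->
  (forall x, f x <= `|x|) -> bounded_functional f.
Proof.
move=> lf fle; split=> //; exists 1 => // x.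
by rewrite mul1r; exact: dominated_functional.
Qed.

Lemma norm_sublinear : sublinear (fun x : Y => `|x|).
Proof. by split=> [x y|t x t0]; [exact: ler_normD|rewrite normrZ ger0_norm]. Qed.

Lemma norming_functional x :
  exists h, [/\ bounded_functional h, forall y, h y <= `|y| & h x = `|x|].
Proof.
have [h [lh hle hx]] := hahn_banach x norm_sublinear.
by exists h; split=> //; exact: dominated_bounded_functional.
Qed.

(** [convex_set] with plain real weights. *)
Definition convex_simple A := forall x y (t : R), 0 <= t -> t <= 1 ->
  A x -> A y -> A (t *: x + (1 - t) *: y).

Lemma convex_setP A : convex_set A <-> convex_simple A.
Proof.
split=> [cA x y t t0 t1 Ax Ay|cA x y l /set_mem Ax /set_mem Ay].
  have t01 : (0%R <= t <= 1%R)%O by rewrite t0 t1.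
  have := cA x y (@Itv01 R t t0 t1) (mem_set Ax) (mem_set Ay).
  by move=> /set_mem.
by apply: mem_set; exact: cA.
Qed.

Lemma closureP A x : closure A x <->
  forall e : R, 0 < e -> exists2 y, A y & `|x - y| < e.
Proof.
split=> [cA e e0|h B /nbhs_ballP[e /= e0 eB]].
  have [y [Ay]] := cA _ (nbhsx_ballx x e e0).
  by rewrite -ball_normE => ?; exists y.
have [y Ay xy] := h e e0; exists y; split=> //.
by apply: eB; rewrite -ball_normE.
Qed.

Lemma conv_hull_convex B : convex_simple (conv_hull B).
Proof.
move=> x y t t0 t1 hx hy A [cA BA].
by apply: (convex_setP _).1 => //; [exact: hx|exact: hy].
Qed.

Lemma conv_hull_min B P : convex_simple P -> B `<=` P -> conv_hull B `<=` P.
Proof. by move=> /convex_setP cP BP; exact: smallest_sub. Qed.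

Lemma sub_conv_hull B : B `<=` conv_hull B.
Proof. exact: sub_gen_smallest. Qed.

Lemma closure_convex A : convex_simple A -> convex_simple (closure A).
Proof.
move=> cA x y t t0 t1 /closureP Ax /closureP Ay; apply/closureP => e e0.
have [x' Ax' xx'] := Ax _ e0; have [y' Ay' yy'] := Ay _ e0.
exists (t *: x' + (1 - t) *: y'); first exact: cA.
rewrite opprD addrACA -!scalerBr (le_lt_trans (ler_normD _ _))//.
rewrite !normrZ (ger0_norm t0) ger0_norm ?subr_ge0//.
have [->|tn0] := eqVneq t 0; first by rewrite mul0r subr0 mul1r add0r.
have : t * `|x - x'| < t * e by rewrite ltr_pM2l// lt_neqAle eq_sym tn0.
have : (1 - t) * `|y - y'| <= (1 - t) * e by rewrite ler_wpM2l ?subr_ge0// ltW.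
lra.
Qed.

Definition hull B := closure (conv_hull B).

Lemma hull_convex B : convex_simple (hull B).
Proof. by apply: closure_convex; exact: conv_hull_convex. Qed.

Lemma sub_hull B : B `<=` hull B.
Proof. by move=> x Bx; apply: subset_closure; exact: sub_conv_hull. Qed.

Lemma closed_hull B : closed (hull B).
Proof. exact: closed_closure. Qed.

Lemma hull_min B P : convex_simple P -> closed P -> B `<=` P -> hull B `<=` P.
Proof.
move=> cP kP BP; rewrite (closure_id P).1//; apply: closureS.
exact: conv_hull_min.
Qed.

Lemma hullN B : (forall x, B x -> B (- x)) -> symmetric_set (hull B).
Proof.
move=> BN.
have cN x : conv_hull B x -> conv_hull B (- x).
  move: x; apply: conv_hull_min; last by move=> x /BN; exact: sub_conv_hull.
  move=> x y t t0 t1 hx hy /=; rewrite opprD -!scalerN.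
  exact: conv_hull_convex.
have hN x : hull B x -> hull B (- x).
  move=> /closureP hx; apply/closureP => e e0; have [y hy xy] := hx _ e0.
  by exists (- y); [exact: cN|rewrite -opprD normrN].
apply/seteqP; split=> [_ [x hx <-]|x hx]; first exact: hN.
by exists (- x); [exact: hN|rewrite opprK].
Qed.

(** The inequality [f (a - x) >= r] for [x] in [A] is a Mazur-Orlicz constraint:
    the cone generated by the pairs [(r, a - x)] lies below the norm because [A]
    has distance at least [r] to [a]. *)
Lemma separation a A (r : R) : convex_simple A -> 0 < r ->
  (forall x, A x -> r <= `|a - x|) ->
  exists f, [/\ bounded_functional f, forall y, f y <= `|y| &
    forall x, A x -> f x <= f a - r].
Proof.
move=> cA r0 Ar.
pose N (t : R) z := (t = 0 /\ z = 0) \/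
  exists s x, [/\ 0 < s, A x, t = s * r & z = s *: (a - x)].
have [|||||f [lf fle fN]] := @mazur_orlicz R Y (fun x => `|x|) N.
- exact: norm_sublinear.
- by left.
- move=> _ t y z [[-> ->]|[s1 [x1 [s10 Ax1 -> ->]]]]; first by rewrite !add0r.
  move=> [[-> ->]|[s2 [x2 [s20 Ax2 -> ->]]]].
    by rewrite !addr0; right; exists s1, x1.
  right; have s0 : 0 < s1 + s2 by rewrite addr_gt0.
  exists (s1 + s2), (s1 / (s1 + s2) *: x1 + (1 - s1 / (s1 + s2)) *: x2).
  split=> //.
  - apply: cA => //; first by rewrite divr_ge0// ltW.
    by rewrite ler_pdivrMr// mul1r lerDl ltW.
  - by rewrite mulrDl.
  - rewrite !scalerBr [in RHS]scalerDr !scalerA mulrBr mulr1.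
    rewrite [(s1 + s2) * _]mulrC divfK ?gt_eqF//.
    rewrite (addrC s1 s2) addrK scalerDl opprD addrACA.
    by rewrite (addrC (s2 *: a)).
- move=> b t z b0 [[-> ->]|[s [x [s0 Ax -> ->]]]].
    by left; rewrite mulr0 scaler0.
  by right; exists (b * s), x; rewrite mulr_gt0// mulrA scalerA.
- move=> t z [[-> ->]|[s [x [s0 Ax -> ->]]]]; first by rewrite normr0.
  by rewrite normrZ gtr0_norm// ler_wpM2l ?Ar// ltW.
exists f; split=> // [|x Ax]; first exact: dominated_bounded_functional.
have : 1 * r <= f (1 *: (a - x)) by apply: fN; right; exists 1, x.
by rewrite mul1r scale1r linear_functionalB//; lra.
Qed.

End Functionals.

(** * The Daugavet property through points of the ball *)

Section Daugavet.
Context {R : realType} {Y : normedModType R}.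
Implicit Types (f g h : Y -> R) (x y z a : Y) (Z : set Y).

(** Every open half-space that contains a point of the ball of [Z] contains a
    point of that ball almost norm-additive with [y].  This form mentions no
    supremum and passes to subsets [Z]. *)
Definition daugavet_on Z := forall f a y (e : R), bounded_functional f ->
  Z a -> `|a| <= 1 -> Z y -> 0 < e ->
  exists x, [/\ Z x, `|x| <= 1, f a - e < f x & 1 + `|y| - e < `|x + y|].

Lemma opnorm_has_sup (T : Y -> Y) K :
  (forall x, `|T x| <= K * `|x|) -> 0 <= K ->
  has_sup [set `|T x| | x in [set x : Y | `|x| <= 1]].
Proof.
move=> TK K0; split; first by exists `|T 0|, 0 => //=; rewrite normr0.
exists K => _ [x /= x1 <-]; rewrite (le_trans (TK x))//.
by rewrite ler_piMr.
Qed.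

Lemma ex_unit_vector y : y != 0 -> exists2 x : Y, `|x| = 1 & y = `|y| *: x.
Proof.
move=> y0; exists (`|y|^-1 *: y).
  by rewrite normrZ normfV normr_id mulVf// normr_eq0.
by rewrite scalerA divff ?scale1r// normr_eq0.
Qed.

(** If [x + T x] almost attains the norm of [I + T] for the operator
    [T x = (f x / c) *: y], where [c] is the norm of [f], then [f x] must be
    almost [c] up to sign, and [T x] is almost [y]. *)
Lemma daugavet_rank_one f y (e : R) : daugavet_property Y ->
  bounded_functional f -> (exists x, f x != 0) -> y != 0 -> 0 < e ->
  exists x, [/\ `|x| <= 1, forall a, `|a| <= 1 -> f a - e < f x &
    1 + `|y| - e < `|x + y|].
Proof.
move=> dY bf [x0 fx0] y0 e0; have [lf [K K0 fK]] := bf.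
pose S := [set `|f x| | x in [set x : Y | `|x| <= 1]].
have supS : has_sup S.
  split; first by exists `|f 0|, 0 => //=; rewrite normr0.
  exists K => _ [x /= x1 <-]; rewrite (le_trans (fK x))//.
  by rewrite ler_piMr// ltW.
pose c := sup S.
have fc x : `|x| <= 1 -> `|f x| <= c by move=> x1; apply: (ub_le_sup supS.2); exists x.
have c0 : 0 < c.
  have x0n : x0 != 0 by apply: contraNneq fx0 => ->; rewrite linear_functional0.
  have [u u1 xu] := ex_unit_vector x0n.
  apply: lt_le_trans (fc u _); last by rewrite u1.
  by rewrite normr_gt0; apply: contraNneq fx0 => fu; rewrite xu lf.2 fu mulr0.
have y1 : 0 < `|y| by rewrite normr_gt0.
have linT : linear (fun x => (f x / c) *: y).
  by move=> a v w; rewrite lf.1 lf.2 scalerA mulrDl scalerDl -mulrA.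
pose m := GRing.isLinear.Build R Y Y *:%R (fun x => (f x / c) *: y) linT.
pose T : {linear Y -> Y} := HB.pack (fun x => (f x / c) *: y) m.
have TE x : T x = (f x / c) *: y by [].
have TK x : `|T x| <= (K / c * `|y|) * `|x|.
  rewrite TE normrZ normrM normfV (gtr0_norm c0).
  rewrite [leRHS]mulrAC ler_wpM2r// mulrAC ler_wpM2r ?invr_ge0 ?fK// ltW//.
have KT0 : 0 <= K / c * `|y| by rewrite mulr_ge0// divr_ge0// ltW.
have bT : bounded_near T (nbhs (0 : Y)).
  apply/linear_boundedP; near=> r => x; rewrite (le_trans (TK x))//.
  by rewrite ler_wpM2r//.
have rT : rank_one T.
  exists y => //; apply/seteqP; split=> [_ [x _ <-]|_ [a _ <-]].
    by exists (f x / c).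
  exists ((a * c / f x0) *: x0) => //.
  by rewrite TE lf.2 divfK// mulfK ?gt_eqF.
(* The second bound turns the defect of [(f x / c) * `|y|] into one of [f x]. *)
pose e1 := Num.min (e / 2) (e * `|y| / (2 * c)).
have e10 : 0 < e1 by rewrite lt_min !divr_gt0 ?mulr_gt0.
have oT : `|y| - e1 / 2 <= opnorm T.
  have dl : 0 < e1 / 2 * c / `|y| by rewrite divr_gt0 ?mulr_gt0 ?divr_gt0.
  have [_ [x /= x1 <-] hx] := sup_adherent dl supS.
  apply: le_trans (ub_le_sup (opnorm_has_sup TK KT0).2 _); last by exists x.
  rewrite TE normrZ normrM normfV (gtr0_norm c0).
  have : (c - e1 / 2 * c / `|y|) / c * `|y| <= `|f x| / c * `|y|.
    by rewrite ler_wpM2r// ler_wpM2r ?invr_ge0 ?(ltW c0) ?(ltW hx).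
  congr (_ <= _); field; rewrite ?gt_eqF//.
have ITK x : `|x + T x| <= (1 + K / c * `|y|) * `|x|.
  by rewrite (le_trans (ler_normD _ _))// mulrDl mul1r lerD2l TK.
have e20 : 0 < e1 / 2 by rewrite divr_gt0.
have IT0 : 0 <= 1 + K / c * `|y| by rewrite addr_ge0.
have oE : sup [set `|x + T x| | x in [set x : Y | `|x| <= 1]] = 1 + opnorm T.
  exact: dY.
have [_ [x /= x1 <-]] := sup_adherent e20 (opnorm_has_sup ITK IT0).
rewrite oE => hx.
wlog fx : x x1 hx / 0 <= f x.
  move=> H; have [/H|/ltW fx] := leP 0 (f x); first exact.
  apply: (H (- x)); rewrite ?normrN//; last by rewrite linear_functionalN// oppr_ge0.
  by rewrite (_ : - x + T (- x) = - (x + T x)) ?normrN// linearN opprD.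
have {}hx : 1 + `|y| - e1 < `|x + (f x / c) *: y|.
  by apply: le_lt_trans hx; lra.
pose l := f x / c; rewrite -/l in hx.
have l0 : 0 <= l by rewrite divr_ge0// ltW.
have l1 : l <= 1 by rewrite ler_pdivrMr// mul1r (le_trans (ler_norm _))// fc.
have hl : (1 - l) * `|y| < e1.
  have := ler_normD x (l *: y); rewrite normrZ ger0_norm//; lra.
have e1e : e1 <= e / 2 by rewrite ge_min lexx.
have e1c : e1 <= e * `|y| / (2 * c) by rewrite ge_min lexx orbT.
exists x; split=> // [a a1|].
  have fa : f a <= c by rewrite (le_trans (ler_norm _))// fc.
  suff : c - e < f x by lra.
  have fxE : f x = l * c by rewrite divfK// gt_eqF.
  have : (1 - l) * `|y| < e * `|y| / (2 * c) by lra.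
  rewrite -ltr_pdivlMr// (_ : _ / _ = e / (2 * c)); last by field; rewrite !gt_eqF.
  rewrite ltr_pdivlMr ?mulr_gt0//; lra.
have : x + l *: y = (x + y) - (1 - l) *: y.
  by rewrite scalerBl scale1r opprB addrACA subrr addr0.
move=> E; have := ler_normB (x + y) ((1 - l) *: y); rewrite -E.
rewrite normrZ ger0_norm ?subr_ge0//; lra.
Unshelve. all: by end_near. Qed.

Lemma daugavet_on_setT : (exists y : Y, y != 0) -> daugavet_property Y ->
  daugavet_on setT.
Proof.
move=> [y0 y0n0] dY f a y e bf _ a1 _ e0.
have [u u1 _] := ex_unit_vector y0n0.
have [f0|] := pselect (forall x, f x = 0).
  have [->|yn0] := eqVneq y 0.
    by exists u; rewrite !f0 addr0 normr0 u1; split=> //; lra.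
  have [v v1 yv] := ex_unit_vector yn0.
  exists v; rewrite !f0 v1; split=> //; first lra.
  rewrite {2}yv -{1}(scale1r v) -scalerDl normrZ v1 ger0_norm ?addr_ge0//.
  lra.
move=> /existsNP[x /eqP fx].
have fn0 : exists x, f x != 0 by exists x.
have [->|yn0] := eqVneq y 0.
  have un0 : u != 0 by rewrite -normr_gt0 u1.
  have [v [v1 vf vu]] := daugavet_rank_one dY bf fn0 un0 e0.
  exists v; split=> //; first exact: vf.
  have := ler_normD v u; rewrite addr0 normr0 u1; rewrite u1 in vu; lra.
have [v [v1 vf vy]] := daugavet_rank_one dY bf fn0 yn0 e0.
by exists v; split=> //; exact: vf.
Qed.

Section Octahedral.
Variables (Z : set Y).
Hypotheses (ZD : forall x y, Z x -> Z y -> Z (x + y)) (dZ : daugavet_on Z).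

Let almost_max f z (r : R) : bounded_functional f -> Z z -> `|z| <= 1 -> 0 < r ->
  exists a, [/\ Z a, `|a| <= 1, f z <= f a &
    forall x, Z x -> `|x| <= 1 -> f x <= f a + r].
Proof.
move=> [_ [K K0 fK]] Zz z1 r0.
pose S := [set f x | x in [set x | Z x /\ `|x| <= 1]].
have supS : has_sup S.
  split; first by exists (f z), z.
  exists K => _ [x /= [_ x1] <-]; rewrite (le_trans (ler_norm _))//.
  by rewrite (le_trans (fK x))// ler_piMr// ltW.
have [_ [a [Za a1] <-] ha] := sup_adherent r0 supS.
have [za|az] := leP (f z) (f a).
  exists a; split=> // x Zx x1.
  have : f x <= sup S by apply: (ub_le_sup supS.2); exists x.
  lra.
exists z; split=> // x Zx x1.
have : f x <= sup S by apply: (ub_le_sup supS.2); exists x.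
lra.
Qed.

(** Treating the vectors of [s] one at a time, each step must return a whole
    slice for the next one to work in.  If [x0] lies almost at the top of a slice
    given by [g] and [h] norms [x0 + y], then the points almost maximizing
    [g + h] are almost maximal for [g] and for [h] at once, and [h] witnesses
    their norm-additivity with [y]. *)
Lemma octahedral_slice (s : seq Y) f a (e : R) : bounded_functional f ->
  Z a -> `|a| <= 1 -> 0 < e -> (forall y, y \in s -> Z y) ->
  exists g b (r : R), [/\ bounded_functional g, Z b, `|b| <= 1, 0 < r &
    forall x, Z x -> `|x| <= 1 -> g b - r < g x ->
      f a - e < f x /\ forall y, y \in s -> 1 + `|y| - e < `|x + y|].
Proof.
move=> bf Za a1 e0; elim: s => [_|y s IH sZ].
  by exists f, a, e; split=> // x _ _ ?; split.
have [|g [b [r [bg Zb b1 r0 H]]]] := IH.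
  by move=> z zs; apply: sZ; rewrite in_cons zs orbT.
pose d := Num.min (r / 4) (e / 6).
have d0 : 0 < d by rewrite lt_min !divr_gt0.
have dr : d <= r / 4 by rewrite ge_min lexx.
have de : d <= e / 6 by rewrite ge_min lexx orbT.
have [c [Zc c1 bc cmax]] := almost_max bg Zb b1 d0.
have Zy : Z y by apply: sZ; rewrite mem_head.
have [x0 [Zx0 x01 gx0 nx0]] := dZ bg Zc c1 Zy d0.
have [h [bh hle hx0]] := norming_functional (x0 + y).
have hD := bh.1.1 x0 y.
exists (fun x => 1 * g x + 1 * h x), x0, d; split=> //.
  exact: bounded_functional_comb.
move=> x Zx x1 hx.
have gx := cmax x Zx x1; have hx1 := hle x; have hy1 := hle y.
have hx01 := hle x0.
have [|fx sx] := H x Zx x1; first lra.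
split=> // z; rewrite in_cons => /predU1P[->|/sx//].
have := hle (x + y); rewrite bh.1.1; lra.
Qed.

Lemma octahedral_seq (s : seq Y) f a (e : R) : bounded_functional f ->
  Z a -> `|a| <= 1 -> 0 < e -> (forall y, y \in s -> Z y) ->
  exists x, [/\ Z x, `|x| <= 1, f a - e < f x &
    forall y, y \in s -> 1 + `|y| - e < `|x + y|].
Proof.
move=> bf Za a1 e0 sZ.
have [g [b [r [_ Zb b1 r0 H]]]] := octahedral_slice bf Za a1 e0 sZ.
have [|fb sb] := H b Zb b1; first lra.
by exists b.
Qed.

Lemma ex_grid (M e : R) : 0 < e ->
  exists s : seq R, forall t, `|t| <= M -> exists2 q, q \in s & `|t - q| <= e.
Proof.
move=> e0; have [M0|M0] := ltP M 0.
  by exists [::] => t tM; have := normr_ge0 t; lra.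
pose N := Num.truncn (2 * M / e).
exists [seq e * i%:R - M | i <- iota 0 N.+1] => t tM.
have := tM; rewrite ler_norml => /andP[t1 t2].
have pos : 0 <= (t + M) / e by rewrite divr_ge0 ?(ltW e0)//; lra.
exists (e * (Num.truncn ((t + M) / e))%:R - M).
  apply/mapP; exists (Num.truncn ((t + M) / e)) => //.
  rewrite mem_iota add0n ltnS /N; apply: le_truncn.
  by rewrite ler_pM2r ?invr_gt0//; lra.
have /andP[h1 h2] := truncn_itv pos.
move: h1 h2; rewrite ler_pdivlMr// ltr_pdivrMr// -natr1 => h1 h2.
rewrite ler_norml; apply/andP; split; lra.
Qed.

Variables (u v : Y).
Hypotheses (Zu : Z u) (Zv : Z v) (ZZ : forall (t : R) x, Z x -> Z (t *: x)).

(** Almost norm-additivity is stable under small perturbations of the vector, so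
    a finite grid handles all the points of a bounded box of the plane. *)
Lemma octahedral_box f a y (M e : R) : bounded_functional f ->
  Z a -> `|a| <= 1 -> Z y -> 0 < e ->
  exists x, [/\ Z x, `|x| <= 1, f a - e < f x &
    forall s t, `|s| <= M -> `|t| <= M ->
      1 + `|y + (s *: u + t *: v)| - e < `|x + (y + (s *: u + t *: v))|].
Proof.
move=> bf Za a1 Zy e0.
pose L := `|u| + `|v| + 1.
have L0 : 0 < L by have := normr_ge0 u; have := normr_ge0 v; rewrite /L; lra.
pose d := e / (3 * L); have d0 : 0 < d by rewrite divr_gt0// mulr_gt0.
have [g hg] := ex_grid M d0.
pose s := [seq y + (p *: u + q *: v) | p <- g, q <- g].
have sZ z : z \in s -> Z z.
  by move=> /allpairsP[[p q] /= [_ _ ->]]; apply: (ZD Zy); apply: ZD; exact: ZZ.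
have e30 : 0 < e / 3 by rewrite divr_gt0.
have [x [Zx x1 fx hx]] := octahedral_seq bf Za a1 e30 sZ.
exists x; split=> //; first lra.
move=> p q /hg[p' p'g pp'] /hg[q' q'g qq'].
have : y + (p' *: u + q' *: v) \in s by apply/allpairsP; exists (p', q').
move=> /hx; set z' := y + _; set z := y + _ => hz.
have zz' : `|z - z'| <= e / 3.
  have -> : z - z' = (p - p') *: u + (q - q') *: v.
    by rewrite !scalerBl /z /z' opprD addrACA subrr add0r opprD addrACA.
  rewrite (le_trans (ler_normD _ _))// !normrZ.
  have : `|p - p'| * `|u| <= d * `|u| by rewrite ler_wpM2r.
  have : `|q - q'| * `|v| <= d * `|v| by rewrite ler_wpM2r.
  have : d * L = e / 3 by rewrite /d; field; rewrite gt_eqF.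
  by rewrite /L !mulrDr; lra.
have := ler_normD z' (z - z'); rewrite [z' + _]addrC subrK.
have := ler_normB (x + z) (z - z').
rewrite opprB (_ : x + z + (z' - z) = x + z'); last by rewrite -addrA [z + _]addrC subrK.
lra.
Qed.

End Octahedral.
End Daugavet.

(** * Distance to a plane *)

Section PlaneDistance.
Context {R : realType} {Y : normedModType R}.
Implicit Types (x y z u v : Y).

(** The norm of the quotient by the span of [u] and [v].  As a lowering of the
    norm along that plane, it is sublinear by construction. *)
Definition plane_dist u v : Y -> R :=
  lowering (fun x => `|x|)
    (fun r z => r = 0 /\ exists s t, z = s *: u + t *: v).

Lemma plane_distC u v : plane_dist u v = plane_dist v u.
Proof.
congr lowering; apply/funext => r; apply/funext => z; apply/propext.
by split=> -[-> [s [t ->]]]; split=> //; exists t, s; rewrite addrC.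
Qed.

Variables u v : Y.
Local Notation d := (plane_dist u v).
Local Notation W s t := (s *: u + t *: v).
Local Notation N := (fun (r : R) z => r = 0 /\ exists s t, z = W s t).

Let N0 : N 0 0.
Proof. by split=> //; exists 0, 0; rewrite !scale0r addr0. Qed.

Let ND (s t : R) y z : N s y -> N t z -> N (s + t) (y + z).
Proof.
move=> [-> [a [b ->]]] [-> [a' [b' ->]]]; rewrite addr0; split=> //.
by exists (a + a'), (b + b'); rewrite !scalerDl addrACA.
Qed.

Let NZ (a t : R) z : 0 < a -> N t z -> N (a * t) (a *: z).
Proof.
move=> _ [-> [s [r ->]]]; rewrite mulr0; split=> //.
by exists (a * s), (a * r); rewrite scalerDr !scalerA.
Qed.

Let Np (t : R) z : N t z -> t <= `|z|.
Proof. by move=> [-> _]. Qed.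

Lemma plane_dist_sublinear : sublinear d.
Proof. exact: (lowering_sublinear norm_sublinear N0 ND NZ Np). Qed.

Lemma plane_dist_le_shift x s t : d x <= `|x + W s t|.
Proof.
have h : N 0 (W s t) by split=> //; exists s, t.
by have := lowering_le_at norm_sublinear N0 Np x h; rewrite subr0.
Qed.

Lemma plane_dist_le x : d x <= `|x|.
Proof. by have := plane_dist_le_shift x 0 0; rewrite !scale0r !addr0. Qed.

Lemma plane_dist_adherent x (e : R) : 0 < e ->
  exists s t, `|x + W s t| < d x + e.
Proof.
move=> e0.
have [r [z [[-> [s [t ->]]]]]] := lowering_adherent norm_sublinear N0 Np x e0.
by rewrite subr0 => h; exists s, t.
Qed.

Lemma plane_dist_ge0 x : 0 <= d x.
Proof.
apply/ler_addgt0Pr => e e0; have [s [t /ltW]] := plane_dist_adherent x e0.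
exact: le_trans.
Qed.

Lemma plane_dist_plane s t : d (W s t) = 0.
Proof.
apply/eqP; rewrite eq_le plane_dist_ge0 andbT.
have := plane_dist_le_shift (W s t) (- s) (- t).
by rewrite !scaleNr -opprD subrr normr0.
Qed.

Lemma plane_distN x : d (- x) = d x.
Proof.
suff h y : d (- y) <= d y.
  by apply/eqP; rewrite eq_le h/= -{1}(opprK x) h.
apply/ler_addgt0Pr => e e0; have [s [t /ltW]] := plane_dist_adherent y e0.
apply: le_trans; have := plane_dist_le_shift (- y) (- s) (- t).
by rewrite !scaleNr -!opprD normrN.
Qed.

Lemma plane_distZ (a : R) x : d (a *: x) = `|a| * d x.
Proof.
have [a0|a0] := leP 0 a; first by rewrite plane_dist_sublinear.2// ger0_norm.
rewrite -(opprK a) scaleNr plane_distN normrN plane_dist_sublinear.2 ?oppr_ge0 ?ltW//.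
by rewrite gtr0_norm// oppr_gt0.
Qed.

Lemma plane_distD x y : d (x + y) <= d x + d y.
Proof. exact: plane_dist_sublinear.1. Qed.

Lemma plane_dist_shift x s t : d (x + W s t) = d x.
Proof.
apply/eqP; rewrite eq_le; apply/andP; split.
  by have := plane_distD x (W s t); rewrite plane_dist_plane addr0.
have := plane_distD (x + W s t) (- W s t); rewrite addrK plane_distN.
by rewrite plane_dist_plane addr0.
Qed.

Lemma plane_dist_lipschitz x y : d x <= d y + `|x - y|.
Proof.
have := plane_distD y (x - y); rewrite addrC subrK.
by have := plane_dist_le (x - y); lra.
Qed.

(** Being dominated by [d], such a functional vanishes on the plane. *)
Lemma plane_dist_functional b :
  exists g, [/\ bounded_functional g, forall x, g x <= d x & g b = d b].
Proof.
have [g [lg gd gb]] := hahn_banach b plane_dist_sublinear.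
exists g; split=> //; apply: dominated_bounded_functional => // x.
exact: le_trans (gd x) (plane_dist_le x).
Qed.

End PlaneDistance.

(** * Projection along a plane *)

Section PlaneProjection.
Context {R : realType} {Y : normedModType R}.
Implicit Types (x y z : Y).

Definition biorthogonal (u v : Y) (phi psi : Y -> R) :=
  [/\ bounded_functional phi, bounded_functional psi,
      phi u = 1 /\ phi v = 0 & psi u = 0 /\ psi v = 1].

Lemma biorthogonalC u v phi psi :
  biorthogonal u v phi psi -> biorthogonal v u psi phi.
Proof. by move=> [? ? [? ?] [? ?]]; split. Qed.

Definition plane_proj (u v : Y) (phi psi : Y -> R) x :=
  x - (phi x *: u + psi x *: v).

Variables (u v : Y) (phi psi : Y -> R).
Hypothesis biorth : biorthogonal u v phi psi.
Local Notation P := (plane_proj u v phi psi).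
Local Notation d := (plane_dist u v).
Local Notation W s t := (s *: u + t *: v).

Lemma phi_plane s t : phi (W s t) = s.
Proof.
by case: biorth => [[lf _] _ [f1 f0] _]; rewrite lf.1 !lf.2 f1 f0; ring.
Qed.

Lemma psi_plane s t : psi (W s t) = t.
Proof.
by case: biorth => [_ [lf _] _ [f1 f0]]; rewrite lf.1 !lf.2 f1 f0; ring.
Qed.

Lemma phi_proj x : phi (P x) = 0.
Proof.
by case: biorth => [[lf _] _ _ _]; rewrite linear_functionalB// phi_plane subrr.
Qed.

Lemma psi_proj x : psi (P x) = 0.
Proof.
by case: biorth => [_ [lf _] _ _]; rewrite linear_functionalB// psi_plane subrr.
Qed.

Lemma proj_id x : phi x = 0 -> psi x = 0 -> P x = x.
Proof. by rewrite /plane_proj => -> ->; rewrite !scale0r addr0 subr0. Qed.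

Lemma proj_decomp x : x = P x + W (phi x) (psi x).
Proof. by rewrite subrK. Qed.

Lemma plane_dist_proj x : d (P x) = d x.
Proof. by rewrite {2}(proj_decomp x) plane_dist_shift. Qed.

Lemma proj_linearD x y : P (x + y) = P x + P y.
Proof.
case: biorth => [[lf _] [lg _] _ _]; rewrite /plane_proj lf.1 lg.1.
by rewrite [RHS]addrACA -opprD; congr (_ - _); rewrite !scalerDl addrACA.
Qed.

Lemma proj_linearZ (a : R) x : P (a *: x) = a *: P x.
Proof.
case: biorth => [[lf _] [lg _] _ _]; rewrite /plane_proj lf.2 lg.2.
by rewrite scalerBr scalerDr !scalerA.
Qed.

Lemma proj_bounded : exists2 K, 0 < K & forall x, `|P x| <= K * `|x|.
Proof.
case: biorth => [[_ [K K0 fK]] [_ [L L0 gL]] _ _].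
exists (1 + K * `|u| + L * `|v|).
  have := mulr_ge0 (ltW K0) (normr_ge0 u); have := mulr_ge0 (ltW L0) (normr_ge0 v).
  lra.
move=> x; rewrite (le_trans (ler_normB _ _))// !mulrDl mul1r -addrA lerD2l.
rewrite (le_trans (ler_normD _ _))// !normrZ lerD//.
  by rewrite mulrAC ler_wpM2r.
by rewrite mulrAC ler_wpM2r.
Qed.

Lemma proj_functional f : bounded_functional f ->
  bounded_functional (fun x => f (P x)).
Proof.
move=> [lf [K K0 fK]]; split.
  by split=> [x y|a x] /=; [rewrite proj_linearD lf.1|rewrite proj_linearZ lf.2].
have [L L0 PL] := proj_bounded.
exists (K * L); first by rewrite mulr_gt0.
by move=> x; rewrite (le_trans (fK _))// -mulrA ler_wpM2l// ltW.
Qed.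

(** The projection is bounded and fixes the kernel of both functionals while
    killing the plane, so it cannot enlarge the distance to the plane by more
    than its norm. *)
Lemma norm_le_plane_dist : exists2 K, 0 < K &
  forall x, phi x = 0 -> psi x = 0 -> `|x| <= K * d x.
Proof.
have [K K0 PK] := proj_bounded; exists K => // x x1 x2.
rewrite -ler_pdivrMl//; apply/ler_addgt0Pr => e e0.
have [s [t /ltW]] := plane_dist_adherent u v x e0; apply: le_trans.
rewrite ler_pdivrMl//; have := PK (x + W s t).
have [[lf _] [lg _] _ _] := biorth.
by rewrite /plane_proj lf.1 lg.1 x1 x2 !add0r phi_plane psi_plane addrK.
Qed.

End PlaneProjection.

(** * Sets generated by strongly exposed points *)

Section StronglyExposed.
Context {R : realType} {Y : normedModType R}.
Implicit Types (x y z : Y) (A B G : set Y) (f q : Y -> R).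

Lemma bounded_setP A : (exists M : R, forall x, A x -> `|x| <= M) <-> bounded_set A.
Proof.
split=> [[M AM]|/pinfty_ex_gt0[M M0 AM]]; last by exists M.
rewrite /= /bounded_near; near=> r => x /AM /le_trans; apply; near: r.
by apply: nbhs_pinfty_ge; exact: num_real.
Unshelve. all: by end_near. Qed.

Lemma closed_sublevel q (L c : R) : 0 < L ->
  (forall x y, q x <= q y + L * `|x - y|) -> closed [set x | q x <= c].
Proof.
move=> L0 qL x /closureP cx /=; apply/ler_addgt0Pr => e e0.
have eL : 0 < e / L by rewrite divr_gt0.
have [y /= yc] := cx _ eL; rewrite ltr_pdivlMr// mulrC => /ltW xy.
by rewrite (le_trans (qL x y))// lerD.
Qed.

Lemma convex_sublevel q (c : R) :
  (forall x y t, 0 <= t -> t <= 1 ->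
     q (t *: x + (1 - t) *: y) <= t * q x + (1 - t) * q y) ->
  convex_simple [set x | q x <= c].
Proof.
move=> qc x y t t0 t1 /= xc yc; rewrite (le_trans (qc x y t t0 t1))//.
have : t * q x <= t * c by rewrite ler_wpM2l.
have : (1 - t) * q y <= (1 - t) * c by rewrite ler_wpM2l// subr_ge0.
lra.
Qed.

(** The estimate holds at the generators and defines a closed convex set. *)
Lemma strongly_exposed_hull G f x0 (g M : R) : bounded_functional f ->
  0 < g -> 0 < M -> (forall x, G x -> `|x - x0| <= M) ->
  (forall x, G x -> x = x0 \/ f x <= f x0 - g) ->
  forall y, hull G y -> g * `|y - x0| <= M * (f x0 - f y).
Proof.
move=> [lf [K K0 fK]] g0 M0 GM Gf y Gy.
pose q x := g * `|x - x0| + M * f x.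
suff : q y <= M * f x0 by rewrite /q; lra.
move: y Gy; apply: hull_min.
- apply: convex_sublevel => x y t t0 t1; rewrite /q lf.1 !lf.2.
  have -> : t *: x + (1 - t) *: y - x0 = t *: (x - x0) + (1 - t) *: (y - x0).
    rewrite !scalerBr addrACA -opprD -scalerDl addrCA subrr addr0 scale1r//.
  have := ler_normD (t *: (x - x0)) ((1 - t) *: (y - x0)).
  rewrite !normrZ (ger0_norm t0) ger0_norm ?subr_ge0// => /(ler_wpM2l (ltW g0)).
  lra.
- apply: (@closed_sublevel _ (g + M * K)) => [|x y].
    by rewrite addr_gt0// mulr_gt0.
  rewrite /q; have := ler_normD (y - x0) (x - y).
  rewrite addrC addrA subrK => /(ler_wpM2l (ltW g0)).
  have := le_trans (ler_norm _) (fK (x - y)); rewrite linear_functionalB//.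
  by move=> /(ler_wpM2l (ltW M0)); lra.
- move=> x Gx /=; rewrite /q; have [->|fx] := Gf x Gx.
    by rewrite subrr normr0 mulr0 add0r.
  have := ler_wpM2l (ltW g0) (GM x Gx).
  have := ler_wpM2l (ltW M0) fx; lra.
Qed.

Lemma is_slice_functional A f (e : R) : bounded_functional f ->
  (exists x, f x != 0) -> 0 < e -> is_slice A (slice A f e).
Proof.
move=> bf [x fx] e0; have [F cF FE] := bounded_functional_linear bf.
exists F, e; split=> //; first by exists x; rewrite FE.
by congr slice; apply/funext => z; rewrite FE.
Qed.

(** The slices of width [1 / m] at each generator are enough: the estimate makes
    their diameters shrink to [0], so a set that meets all of them has every
    generator in its closure. *)
Lemma SCD_strongly_exposed (I : countType) (i0 : I) (c : I -> Y) :
  bounded_set (hull (range c)) ->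
  (forall i, exists f (g : R), [/\ bounded_functional f, 0 < f (c i), 0 < g &
     forall y, hull (range c) y -> g * `|y - c i| <= f (c i) - f y]) ->
  SCD (hull (range c)).
Proof.
set A := hull _ => bA H.
have /choice[fg fgP] : forall i, exists p : (Y -> R) * R,
    [/\ bounded_functional p.1, 0 < p.1 (c i), 0 < p.2 &
     forall y, A y -> p.2 * `|y - c i| <= p.1 (c i) - p.1 y].
  by move=> i; have [f [g ?]] := H i; exists (f, g).
pose f i := (fg i).1; pose g i := (fg i).2.
have bf i : bounded_functional (f i) by case: (fgP i).
have fc i : 0 < f i (c i) by case: (fgP i).
have g0 i : 0 < g i by case: (fgP i).
have ex i y : A y -> g i * `|y - c i| <= f i (c i) - f i y.
  by case: (fgP i) => _ _ _; exact.
have Ac i : A (c i) by apply: sub_hull; exists i.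
have supA i : sup (f i @` A) = f i (c i).
  have ub : ubound (f i @` A) (f i (c i)).
    move=> _ [y Ay <-]; have := ex i y Ay.
    have := mulr_ge0 (ltW (g0 i)) (normr_ge0 (y - c i)); lra.
  apply/eqP; rewrite eq_le; apply/andP; split.
    by apply: ge_sup => //; exists (f i (c i)), (c i).
  by apply: ub_le_sup; [exists (f i (c i))|exists (c i)].
pose idx n : I * nat := odflt (i0, 0%N) (unpickle n).
pose U n := slice A (f (idx n).1) ((idx n).2.+1%:R^-1).
split=> //; first by exists (c i0).
exists U; split=> [n|].
  apply: is_slice_functional => //.
    by exists (c (idx n).1); rewrite gt_eqF.
split=> [n|B BU].
  split; last by move=> x [].
  by exists (c (idx n).1); split=> //; rewrite supA ltrBlDr ltrDl invr_gt0.
apply: hull_min; [exact: hull_convex|exact: closed_hull|].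
move=> _ [i _ <-]; apply/closureP => e e0.
have ge0 : 0 < g i * e by rewrite mulr_gt0.
have [m hm] : exists m, m.+1%:R^-1 <= g i * e.
  exists (Num.truncn (g i * e)^-1); rewrite invf_ple ?posrE//.
  by rewrite ltW// truncnS_gt.
have := BU (pickle (i, m)); rewrite /U /idx pickleK/= => -[y [By [Ay]]].
rewrite supA => hy; exists y; first exact: sub_conv_hull.
have := ex i y Ay; rewrite distrC -(ltr_pM2l (g0 i)).
move: hm hy; move: (m.+1%:R^-1) => r hm hy; lra.
Qed.

End StronglyExposed.

(** * The tilted bodies *)

Section TiltParameters.
Context {R : realType}.

(** The exponents are chosen so that [slope n * tilt n] is [4 * shrink n] while
    [slope n] is below [shrink k] for all [k < n]. *)
Definition tilt (n : nat) : R := 2^-1 ^+ n.+1.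
Definition shrink (n : nat) : R := 2^-1 ^+ ((n + 2) * (n + 2)).
Definition slope (n : nat) : R := 2^-1 ^+ ((n + 2) * (n + 2) - (n + 3)).

Lemma half_pow_le m n : (m <= n)%N -> (2^-1 : R) ^+ n <= 2^-1 ^+ m.
Proof. by move=> mn; apply: ler_wiXn2l => //; rewrite ?invr_ge0 ?invf_le1//; lra. Qed.

Lemma half_pow_gt0 n : 0 < (2^-1 : R) ^+ n.
Proof. by rewrite exprn_gt0// invr_gt0. Qed.

Lemma tilt_gt0 n : 0 < tilt n. Proof. exact: half_pow_gt0. Qed.
Lemma shrink_gt0 n : 0 < shrink n. Proof. exact: half_pow_gt0. Qed.
Lemma slope_gt0 n : 0 < slope n. Proof. exact: half_pow_gt0. Qed.

Lemma tilt_le_half n : tilt n <= 2^-1.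
Proof. by have := @half_pow_le 1 n.+1 isT; rewrite expr1. Qed.

Lemma shrink_le_tilt n : shrink n <= tilt n.
Proof. by apply: half_pow_le; nia. Qed.

Lemma slope_le_half n : slope n <= 2^-1.
Proof. by rewrite -[leRHS]expr1; apply: half_pow_le; nia. Qed.

Lemma slope_tilt n : slope n * tilt n = 4 * shrink n.
Proof.
rewrite /slope /tilt /shrink -exprD.
have E : ((n + 2) * (n + 2) = ((n + 2) * (n + 2) - (n + 3) + n.+1) + 2)%N by nia.
by rewrite [in RHS]E (exprD _ (_ + n.+1)%N 2); lra.
Qed.

Lemma slope_separates n k : k != n ->
  slope n * tilt k <= shrink k + 2 * shrink n.
Proof.
rewrite neq_ltn => /orP[kn|nk].
  have : slope n * tilt k <= shrink k.
    by rewrite /slope /tilt /shrink -exprD; apply: half_pow_le; nia.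
  by have := shrink_gt0 n; lra.
have : slope n * tilt k <= slope n * tilt n / 2.
  rewrite -mulrA ler_wpM2l ?(ltW (slope_gt0 n))// /tilt -exprSr.
  exact: half_pow_le.
by rewrite slope_tilt; have := shrink_gt0 k; lra.
Qed.

Lemma tilt_small (e : R) : 0 < e ->
  exists N, forall n, (N <= n)%N -> tilt n < e.
Proof.
move=> e0; exists (Num.truncn e^-1) => n Nn.
rewrite /tilt exprVn -natrX invf_plt ?posrE ?ltr0n ?expn_gt0//.
apply: lt_trans (truncnS_gt _) _; rewrite ltr_nat.
by apply: leq_ltn_trans (ltn_expl n.+1 (isT : 1 < 2)%N); rewrite ltnS.
Qed.

End TiltParameters.

Section TiltedBody.
Context {R : realType} {Y : normedModType R}.
Implicit Types (x y z : Y).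

(** The corners of the square in the plane, and the tilted points with their
    opposites. *)
Definition generator (u v : Y) (b : nat -> Y) (i : bool * bool + bool * nat) : Y :=
  match i with
  | inl (s, t) => (-1) ^+ s *: u + (-1) ^+ t *: v
  | inr (s, n) => (-1) ^+ s *: ((1 - shrink n) *: b n + tilt n *: u)
  end.

Definition tilted_body u v b := hull (range (generator u v b)).

Variables (Z : set Y) (u v : Y) (phi psi : Y -> R) (b : nat -> Y).
Local Notation d := (plane_dist u v).
Local Notation P := (plane_proj u v phi psi).
Local Notation W s t := (s *: u + t *: v).

(** Points are approximated by terms of arbitrarily large index, because only
    those have small tilts. *)
Definition dense_sphere :=
  (forall n, [/\ Z (b n), phi (b n) = 0, psi (b n) = 0 & d (b n) = 1]) /\
  forall z (e : R) N, Z z -> phi z = 0 -> psi z = 0 -> d z = 1 -> 0 < e ->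
    exists2 n, (N <= n)%N & `|z - b n| < e.

Hypotheses (biorth : biorthogonal u v phi psi) (bP : dense_sphere).
Hypotheses (Zu : Z u) (Zv : Z v) (cZ : closed Z)
  (ZD : forall x y, Z x -> Z y -> Z (x + y))
  (ZZ : forall (a : R) x, Z x -> Z (a *: x)).

Local Notation C := (tilted_body u v b).
Local Notation gen := (generator u v b).

Let bphi := let: And4 p _ _ _ := biorth in p.
Let bpsi := let: And4 _ p _ _ := biorth in p.

Lemma signr_norm (s : bool) : `|(-1) ^+ s| = 1 :> R.
Proof. by rewrite normrX normrN1 expr1n. Qed.

Lemma generator_bounded : exists2 M : R, 0 < M & forall i, `|gen i| <= M.
Proof.
have [K K0 dK] := norm_le_plane_dist biorth.
exists (K + `|u| + `|v|); first by have := normr_ge0 u; have := normr_ge0 v; lra.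
have hu := normr_ge0 u; have hv := normr_ge0 v.
move=> [[s t]|[s n]] /=.
  rewrite (le_trans (ler_normD _ _))// !normrZ !signr_norm; lra.
rewrite normrZ signr_norm mul1r (le_trans (ler_normD _ _))// !normrZ.
have [Zb b1 b2 db] := bP.1 n; have := dK _ b1 b2; rewrite db mulr1 => bK.
have s0 := shrink_gt0 (R := R) n; have t0 := tilt_gt0 (R := R) n.
have st := shrink_le_tilt (R := R) n; have th := tilt_le_half (R := R) n.
rewrite ger0_norm; last lra.
rewrite (gtr0_norm t0).
have : (1 - shrink n) * `|b n| <= 1 * `|b n| by rewrite ler_wpM2r//; lra.
have : tilt n * `|u| <= 1 * `|u| by rewrite ler_wpM2r//; lra.
lra.
Qed.

Lemma tilted_body_bounded : bounded_set C.
Proof.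
have [M M0 gM] := generator_bounded.
apply/bounded_setP; exists M; apply: hull_min.
- apply: convex_sublevel => x y t t0 t1; rewrite (le_trans (ler_normD _ _))//.
  by rewrite !normrZ !ger0_norm// subr_ge0.
- apply: (@closed_sublevel _ _ _ 1) => // x y.
  by have := ler_normD y (x - y); rewrite [y + _]addrC subrK mul1r.
- by move=> _ [i _ <-]; exact: gM.
Qed.

Lemma tilted_body_symmetric : symmetric_set C.
Proof.
apply: hullN => _ [i _ <-]; case: i => [[s t]|[s n]].
  exists (inl (~~ s, ~~ t)) => //=.
  by rewrite !signrN !scaleNr opprD.
by exists (inr (~~ s, n)) => //=; rewrite signrN scaleNr.
Qed.

Lemma tilted_body_sub : C `<=` Z.
Proof.
apply: hull_min => //; first by move=> x y t _ _ *; apply: ZD; exact: ZZ.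
move=> _ [[[s t]|[s n]] _ <-] /=; first by apply: ZD; exact: ZZ.
by have [Zb _ _ _] := bP.1 n; apply/ZZ/ZD; exact: ZZ.
Qed.

(** Tilting towards [u] changes neither the distance to the plane nor [psi], so
    the bound can be read off on the generators. *)
Lemma tilted_body_le x : C x -> d x + `|psi x| <= 1.
Proof.
have [lp [K K0 pK]] := bpsi.
move: x; apply: hull_min.
- apply: convex_sublevel => x y t t0 t1.
  have t1' : 0 <= 1 - t by lra.
  have := plane_distD u v (t *: x) ((1 - t) *: y); rewrite !plane_distZ.
  have := ler_normD (psi (t *: x)) (psi ((1 - t) *: y)); rewrite -lp.1 !lp.2.
  by rewrite !normrM (ger0_norm t0) (ger0_norm t1'); lra.
- apply: (@closed_sublevel _ _ _ (1 + K)) => [|x y]; first by rewrite addr_gt0.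
  have := plane_dist_lipschitz u v x y.
  have := ler_normD (psi y) (psi (x - y)); rewrite -lp.1 [y + _]addrC subrK.
  have := pK (x - y); lra.
- move=> _ [[[s t]|[s n]] _ <-] /=.
    by rewrite plane_dist_plane (psi_plane biorth) signr_norm add0r.
  have [_ _ psib db] := bP.1 n.
  have [_ _ _ [psiu _]] := biorth.
  rewrite plane_distZ signr_norm mul1r lp.2 lp.1 !lp.2 psib psiu.
  rewrite !mulr0 addr0 mulr0 normr0 addr0.
  have := plane_dist_shift u v ((1 - shrink n) *: b n) (tilt n) 0.
  rewrite scale0r addr0 => ->; rewrite plane_distZ db mulr1.
  have s0 := shrink_gt0 (R := R) n; have t0 := tilt_gt0 (R := R) n.
  have st := shrink_le_tilt (R := R) n; have th := tilt_le_half (R := R) n.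
  rewrite ger0_norm; lra.
Qed.

Lemma tilted_body_convex : convex_simple C.
Proof. exact: hull_convex. Qed.

Lemma tilted_body_square s t : `|s| <= 1 -> `|t| <= 1 -> C (W s t).
Proof.
have side (e : bool) (t' : R) : `|t'| <= 1 -> C (W ((-1) ^+ e) t').
  rewrite ler_norml => /andP[t1 t2].
  have -> : W ((-1) ^+ e) t' = ((1 + t') / 2) *: gen (inl (e, false))
      + (1 - (1 + t') / 2) *: gen (inl (e, true)).
    rewrite /= expr0 expr1 !scalerDr !scalerA addrACA -(scalerDl u) -(scalerDl v).
    by congr (_ *: _ + _ *: _); field.
  by apply: hull_convex; [lra|lra| |]; apply: sub_hull; eexists.
rewrite ler_norml => /andP[s1 s2] t1.
have -> : W s t = ((1 + s) / 2) *: W ((-1) ^+ false) t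
    + (1 - (1 + s) / 2) *: W ((-1) ^+ true) t.
  rewrite /= expr0 expr1 !scalerDr !scalerA addrACA -(scalerDl u) -(scalerDl v).
  by congr (_ *: _ + _ *: _); field.
by apply: hull_convex; [lra|lra| |]; apply: side.
Qed.

Lemma tilted_body0 : C 0.
Proof.
by have := @tilted_body_square 0 0; rewrite !scale0r addr0 normr0; apply; exact: ler01.
Qed.

(** The tilts and shrinkings vanish along the approximating indices, so the
    untilted sphere is in the closure of the generators. *)
Lemma tilted_body_ball z : Z z -> phi z = 0 -> psi z = 0 -> d z <= 1 -> C z.
Proof.
have [K K0 dK] := norm_le_plane_dist biorth.
have sphere y : Z y -> phi y = 0 -> psi y = 0 -> d y = 1 -> C y.
  move=> Zy y1 y2 dy; apply: closed_hull; apply/closureP => e e0.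
  have L0 : 0 < K + `|u| + 1 by have := normr_ge0 u; lra.
  have e20 : 0 < e / 2 by lra.
  have [N hN] := tilt_small (divr_gt0 e20 L0).
  have [n Nn hn] := bP.2 y (e / 2) N Zy y1 y2 dy e20.
  exists (gen (inr (false, n))); first by apply: sub_hull; exists (inr (false, n)).
  rewrite /= expr0 scale1r.
  have [Zb b1 b2 db] := bP.1 n; have := dK _ b1 b2; rewrite db mulr1 => bK.
  have -> : y - ((1 - shrink n) *: b n + tilt n *: u)
     = (y - b n) + (shrink n *: b n - tilt n *: u).
    by rewrite scalerBl scale1r opprD opprB -!addrA; congr (_ + _); rewrite [RHS]addrCA.
  rewrite (le_lt_trans (ler_normD _ _))//.
  have := ler_normB (shrink n *: b n) (tilt n *: u).
  have s0 := shrink_gt0 (R := R) n; have t0 := tilt_gt0 (R := R) n.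
  have st := shrink_le_tilt (R := R) n.
  rewrite !normrZ (gtr0_norm s0) (gtr0_norm t0).
  have h1 : shrink n * `|b n| <= tilt n * K by rewrite ler_pM// ltW.
  have := hN n Nn; rewrite ltr_pdivlMr// !mulrDr mulr1; lra.
move=> Zz z1 z2 dz.
have [d0|dn0] := eqVneq (d z) 0.
  have := dK z z1 z2; rewrite d0 mulr0 normr_le0 => /eqP ->.
  exact: tilted_body0.
have dz0 : 0 < d z by rewrite lt_neqAle eq_sym dn0 plane_dist_ge0.
have -> : z = d z *: ((d z)^-1 *: z) + (1 - d z) *: 0.
  by rewrite scaler0 addr0 scalerA divff// scale1r.
apply: hull_convex => //; [exact: ltW| |exact: tilted_body0].
apply: sphere; first exact: ZZ.
- by rewrite bphi.1.2 z1 mulr0.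
- by rewrite bpsi.1.2 z2 mulr0.
- by rewrite plane_distZ gtr0_norm ?invr_gt0// mulVf.
Qed.

(** A corner is exposed by the sum of the two coordinates with its own signs.
    For the [n]-th tilted point take [F = h + slope n * phi], where [h] peaks at
    [b n] and vanishes on the plane: its value there is [1 + 3 * shrink n], and
    [slope_separates] keeps it below [1 + 2 * shrink n] at all the others. *)
Lemma generator_exposed i : exists f (g : R),
  [/\ bounded_functional f, 0 < f (gen i), 0 < g &
    forall y, C y -> g * `|y - gen i| <= f (gen i) - f y].
Proof.
have [M M0 gM] := generator_bounded.
suff [f [g [bf f0 g0 H]]] : exists f (g : R),
    [/\ bounded_functional f, 0 < f (gen i), 0 < g &
    forall j, gen j = gen i \/ f (gen j) <= f (gen i) - g].
  have M20 : 0 < 2 * M by rewrite mulr_gt0.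
  exists f, (g / (2 * M)); split=> //; first by rewrite divr_gt0.
  move=> y Cy; rewrite -(ler_pM2l M20) mulrA [2 * M * _]mulrC divfK ?gt_eqF//.
  apply: strongly_exposed_hull Cy => //.
    move=> _ [j _ <-]; have := gM i; have := gM j; have := ler_normB (gen j) (gen i).
    lra.
  by move=> _ [j _ <-]; exact: H.
have [_ _ [phiu phiv] [psiu psiv]] := biorth.
have half (k : nat) : [/\ 0 < shrink k :> R, shrink k <= tilt k :> R,
    tilt k <= 2^-1 :> R & 0 < tilt k :> R].
  by rewrite shrink_gt0 shrink_le_tilt tilt_le_half tilt_gt0.
case: i => [[s t]|[s n]].
  pose F x := (-1) ^+ s * phi x + (-1) ^+ t * psi x.
  have FC s' t' : F (gen (inl (s', t'))) = (-1) ^+ (s (+) s') + (-1) ^+ (t (+) t').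
    by rewrite /F /= (phi_plane biorth) (psi_plane biorth) !signr_addb.
  have FT s' n : F (gen (inr (s', n))) = (-1) ^+ (s (+) s') * tilt n.
    have [_ b1 b2 _] := bP.1 n.
    rewrite /F /= bphi.1.2 bpsi.1.2 bphi.1.1 bpsi.1.1 !bphi.1.2 !bpsi.1.2.
    by rewrite b1 b2 phiu psiu signr_addb; ring.
  exists F, 1; split=> //.
  - exact: bounded_functional_comb.
  - by rewrite FC !addbb expr0; lra.
  move=> [[s' t']|[s' n]]; last first.
    right; rewrite FC FT !addbb expr0; have [s0 st th t0] := half n.
    by case: (s (+) s'); rewrite ?expr1 ?expr0; lra.
  have [/andP[/eqP <- /eqP <-]|ne] := boolP ((s == s') && (t == t')); first by left.
  right; rewrite !FC !addbb expr0.
  by case: s s' t t' ne {FC FT F} => [] [] [] [] //=; rewrite ?expr0 ?expr1; lra.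
have [Zb b1 b2 db] := bP.1 n.
have [h [bh hd hb]] := plane_dist_functional u v (b n); rewrite db in hb.
have hW p q : h (W p q) = 0.
  have := hd (W p q); have := hd (- W p q).
  rewrite plane_distN plane_dist_plane (linear_functionalN _ bh.1); lra.
have hu : h u = 0 by have := hW 1 0; rewrite scale1r scale0r addr0.
pose F x := h x + slope n * phi x.
have FT k : F ((1 - shrink k) *: b k + tilt k *: u)
    = (1 - shrink k) * h (b k) + slope n * tilt k.
  have [_ bk1 _ _] := bP.1 k.
  by rewrite /F bh.1.1 bphi.1.1 !bh.1.2 !bphi.1.2 hu phiu bk1; ring.
have FnE : F ((1 - shrink n) *: b n + tilt n *: u) = 1 + 3 * shrink n.
  by rewrite FT hb slope_tilt; ring.
have lF : linear_functional F.
  by rewrite /F; split=> *; rewrite ?bh.1.1 ?bphi.1.1 ?bh.1.2 ?bphi.1.2; ring.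
have bF : bounded_functional F.
  have := bounded_functional_comb 1 (slope n) bh bphi.
  by congr bounded_functional; apply/funext => x; rewrite mul1r.
have hbk k : `|h (b k)| <= 1.
  have [_ _ _ dk] := bP.1 k.
  have := hd (b k); have := hd (- b k).
  by rewrite plane_distN (linear_functionalN _ bh.1) dk ler_norml; lra.
have [s0 st th t0] := half n.
exists (fun x => (-1) ^+ s * F x), (shrink n); split=> //.
- have := bounded_functional_comb ((-1) ^+ s) 0 bF bF.
  by congr bounded_functional; apply/funext => x; rewrite mul0r addr0.
- by rewrite /= lF.2 mulrA -signr_addb addbb expr0 FnE; lra.
rewrite [gen (inr (s, n))]/= lF.2 mulrA -signr_addb addbb expr0 mul1r FnE.
move=> [[s' t']|[s' k]].
  right; rewrite /= /F hW (phi_plane biorth) add0r.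
  have := slope_le_half (R := R) n; have := slope_gt0 (R := R) n.
  by rewrite mulrCA -signr_addb; case: (s (+) s'); rewrite ?expr1 ?expr0; lra.
rewrite /= lF.2 mulrA -signr_addb.
have [->|kn] := eqVneq k n.
  rewrite FnE; have [<-|ss'] := eqVneq s s'; first by left.
  right; rewrite (_ : s (+) s' = true) ?expr1; last by case: s s' ss' => [] [].
  lra.
right; rewrite (le_trans (ler_norm _))// normrM signr_norm mul1r FT.
have [sk0 skt tkh tk0] := half k.
have sep := slope_separates (R := R) kn.
rewrite (le_trans (ler_normD _ _))//.
rewrite normrM ger0_norm; last lra.
rewrite [`|slope n * _|]gtr0_norm ?mulr_gt0 ?slope_gt0//.
have : (1 - shrink k) * `|h (b k)| <= (1 - shrink k) * 1 by rewrite ler_wpM2l//; lra.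
lra.
Qed.

Lemma tilted_body_SCD : SCD C.
Proof.
apply: SCD_strongly_exposed; [exact: (inl (true, true))|exact: tilted_body_bounded|].
exact: generator_exposed.
Qed.

Lemma tilted_body_interior : (forall x, Z x) -> C° !=set0.
Proof.
move=> ZT; exists 0.
have [_ [K K0 fK]] := bphi; have [_ [L L0 gL]] := bpsi.
pose M := 1 + K + L; have M0 : 0 < M by rewrite addr_gt0 ?addr_gt0.
apply/nbhs_ballP; exists (2 * M)^-1 => /=; first by rewrite invr_gt0 mulr_gt0.
move=> y; rewrite -ball_normE /= sub0r normrN => hy.
have My : 2 * M * `|y| <= 1.
  by rewrite -ler_pdivlMl ?mulr_gt0// mulr1 ltW.
have hK : K * `|y| <= M * `|y| by rewrite ler_wpM2r// /M; lra.
have hL : L * `|y| <= M * `|y| by rewrite ler_wpM2r// /M; lra.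
have h1 : 1 * `|y| <= M * `|y| by rewrite ler_wpM2r// /M; lra.
have -> : y = 2^-1 *: (2 *: P y) + (1 - 2^-1) *: W (2 * phi y) (2 * psi y).
  rewrite (_ : 1 - 2^-1 = 2^-1); last by field.
  rewrite (scalerDr _ (_ *: u)) !scalerA.
  by rewrite !mulKf// mulVf// scale1r -proj_decomp.
apply: hull_convex; [lra|lra| |].
  apply: tilted_body_ball => //.
  - by rewrite bphi.1.2 (phi_proj biorth) mulr0.
  - by rewrite bpsi.1.2 (psi_proj biorth) mulr0.
  - rewrite plane_distZ plane_dist_proj// ger0_norm//.
    by have := plane_dist_le u v y; lra.
have fy := fK y; have gy := gL y.
by apply: tilted_body_square; rewrite normrM (ger0_norm (ler0n _ 2)); lra.
Qed.

End TiltedBody.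

(** * Sets with a Daugavet core are not slicely countably determined *)

Section NotSCD.
Context {R : realType} {Y : normedModType R}.
Variables (Z : set Y) (u v : Y) (phi psi : Y -> R) (A : set Y) (a : Y).
Local Notation d := (plane_dist u v).
Local Notation P := (plane_proj u v phi psi).
Local Notation W s t := (s *: u + t *: v).

Hypotheses (biorth : biorthogonal u v phi psi) (dZ : daugavet_on Z).
Hypotheses (Zu : Z u) (Zv : Z v)
  (ZD : forall x y, Z x -> Z y -> Z (x + y))
  (ZZ : forall (r : R) x, Z x -> Z (r *: x)).
Hypotheses (AZ : A `<=` Z)
  (Aphi : forall y, A y -> d y + `|phi y| <= 1)
  (Apsi : forall y, A y -> d y + `|psi y| <= 1)
  (AW : forall s t, `|s| <= 1 -> `|t| <= 1 -> A (W s t))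
  (AP : forall z, Z z -> phi z = 0 -> psi z = 0 -> d z <= 1 -> A z).
Hypotheses (Za : Z a) (phia : phi a = 0) (psia : psi a = 0) (da : d a = 1).

Let bphi := let: And4 p _ _ _ := biorth in p.
Let bpsi := let: And4 _ p _ _ := biorth in p.

Let ZW s t : Z (W s t). Proof. by apply: ZD; exact: ZZ. Qed.

Let Z0 : Z 0. Proof. by rewrite -(scale0r u); exact: ZZ. Qed.

Let ZB x y : Z x -> Z y -> Z (x - y).
Proof. by move=> Zx Zy; rewrite -scaleN1r; exact/ZD/ZZ. Qed.

Let A_proj x : Z x -> `|x| <= 1 -> A (P x).
Proof.
move=> Zx x1; apply: AP; [exact: ZB|exact: phi_proj|exact: psi_proj|].
by rewrite plane_dist_proj// (le_trans (plane_dist_le _ _ _)).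
Qed.

(** A point of [A] is a combination, with weights [d y] and [1 - d y], of a
    point of the projected ball and a point of the square; so if [f] is small on
    the square, its supremum is approached on the projected ball. *)
Lemma slice_dichotomy f (e : R) : bounded_functional f -> 0 < e -> bounded_set A ->
  (exists s t, [/\ `|s| <= 1, `|t| <= 1 & slice A f e (W s t)]) \/
  (exists x, [/\ Z x, `|x| <= 1 & sup (f @` A) - e / 2 < f (P x)]).
Proof.
move=> bf e0 /bounded_setP[B AB]; have [lf [K K0 fK]] := bf.
pose sg := sup (f @` A).
have supA : has_sup (f @` A).
  split; first by exists (f a), a => //; apply: AP => //; rewrite da.
  exists (K * B) => _ [y Ay <-]; rewrite (le_trans (ler_norm _))//.
  by rewrite (le_trans (fK y))// ler_wpM2l ?AB// ltW.
pose m := `|f u| + `|f v|.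
have m0 : 0 <= m by rewrite addr_ge0.
have [mlt|mge] := ltP (sg - e) m.
  (* [m] is the maximum of [f] on the square, attained at this corner. *)
  left; exists (Num.sg (f u)), (Num.sg (f v)).
  have sg1 (r : R) : `|Num.sg r| <= 1 by rewrite normr_sg; case: (r != 0).
  split=> //; split; first exact: AW.
  by rewrite lf.1 !lf.2 -!normrEsg.
right.
have sg0 : 0 < sg + 1 by lra.
have e40 : 0 < e / 4 by lra.
have [_ [y Ay <-] hy] := sup_adherent e40 supA; rewrite -/sg in hy.
pose eta := e / (4 * (sg + 1)); have eta0 : 0 < eta by rewrite divr_gt0// mulr_gt0.
have etasg : eta * (sg + 1) = e / 4.
  by rewrite /eta; field; rewrite gt_eqF.
have [s [t hst]] := plane_dist_adherent u v (P y) eta0.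
rewrite plane_dist_proj// in hst.
have dy0 := plane_dist_ge0 u v y.
pose r := d y + eta; have r0 : 0 < r by rewrite ltr_wpDl.
pose x := r^-1 *: (P y + W s t).
have Zx : Z x by apply/ZZ/ZD; [exact/ZB/ZW/AZ|exact: ZW].
have Px : P x = r^-1 *: P y.
  rewrite proj_linearZ// proj_linearD//; congr (_ *: _).
  rewrite (proj_id u v (phi_proj biorth y) (psi_proj biorth y)).
  have -> : P (W s t) = 0.
    by rewrite /plane_proj (phi_plane biorth) (psi_plane biorth) subrr.
  by rewrite addr0.
exists x; split=> //.
  by rewrite normrZ gtr0_norm ?invr_gt0// ler_pdivrMl// mulr1 ltW.
rewrite ltNge; apply/negP => hx.
have fy : f y = r * f (P x) + (phi y * f u + psi y * f v).
  rewrite Px lf.2 mulrA divff ?gt_eqF// mul1r -!lf.2 -!lf.1.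
  by rewrite -proj_decomp.
have h1 : r * f (P x) <= r * (sg - e / 2) by rewrite ler_wpM2l// ltW.
have h2 : phi y * f u <= (1 - d y) * `|f u|.
  rewrite (le_trans (ler_norm _))// normrM ler_wpM2r//.
  by have := Aphi Ay; lra.
have h3 : psi y * f v <= (1 - d y) * `|f v|.
  rewrite (le_trans (ler_norm _))// normrM ler_wpM2r//.
  by have := Apsi Ay; lra.
have d1 : 0 <= 1 - d y by have := Aphi Ay; have := normr_ge0 (phi y); lra.
have h4 : (1 - d y) * m <= (1 - d y) * (sg - e / 2) by rewrite ler_wpM2l//; lra.
have h5 : r * (sg - e / 2) + (1 - d y) * (sg - e / 2) = (1 + eta) * (sg - e / 2).
  by rewrite /r; ring.
have h6 : 0 <= eta * e by rewrite mulr_ge0// ltW.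
have {}h4 : (1 - d y) * `|f u| + (1 - d y) * `|f v| <= (1 - d y) * (sg - e / 2).
  by rewrite -mulrDr.
lra.
Qed.

Lemma slice_octahedral f (e M r : R) y : bounded_functional f -> 0 < e ->
  bounded_set A -> Z y -> 0 < r ->
  exists x, [/\ Z x, `|x| <= 1,
    forall s t, `|s| <= M -> `|t| <= M ->
      1 + `|y + W s t| - r < `|x + (y + W s t)| &
    (exists s t, [/\ `|s| <= 1, `|t| <= 1 & slice A f e (W s t)]) \/
    slice A f e (P x)].
Proof.
move=> bf e0 bA Zy r0.
have bfP := proj_functional biorth bf.
have [sq|[z [Zz z1 fz]]] := slice_dichotomy bf e0 bA.
  have [|x [Zx x1 _ hx]] := octahedral_box ZD dZ Zu Zv ZZ M bfP Z0 _ Zy r0.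
    by rewrite normr0.
  by exists x; split=> //; left.
have r'0 : 0 < Num.min r (e / 2) by rewrite lt_min r0 divr_gt0.
have [x [Zx x1 fx hx]] := octahedral_box ZD dZ Zu Zv ZZ M bfP Zz z1 Zy r'0.
have rr : Num.min r (e / 2) <= r by rewrite ge_min lexx.
have re : Num.min r (e / 2) <= e / 2 by rewrite ge_min lexx orbT.
exists x; split=> //.
  by move=> s t sM tM; have := hx s t sM tM; lra.
right; split; first exact: A_proj.
lra.
Qed.

(** The points chosen in the slices are [P (x n)] or lie in the square.  A convex
    combination of them is [X + w] with [X] a combination of the [x n] and [w] in
    a bounded box of the plane.  A functional [h] norming [w - a] plus the sum of
    the first [x n] is nonnegative on these [x n] and almost norms [w - a], so
    [`|X + w - a| >= h (w - a) >= d a - 1/2]. *)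
Lemma not_SCD : ~ SCD A.
Proof.
move=> [_ bA [U [Uslice [_ Udet]]]].
have [_ [K K0 fK]] := bphi; have [_ [L L0 gL]] := bpsi.
(* The box has to contain the square and the plane components [W (phi x) (psi x)]
   for [x] in the ball. *)
pose M := 1 + K + L.
have step n : exists F : Y -> Y, forall S, Z S -> [/\ Z (F S), `|F S| <= 1,
    forall s t, `|s| <= M -> `|t| <= M ->
      1 + `|(S - a) + W s t| - tilt n.+1 < `|F S + ((S - a) + W s t)| &
    (exists s t, [/\ `|s| <= 1, `|t| <= 1 & U n (W s t)]) \/ U n (P (F S))].
  have [f [e [cf _ e0 UE]]] := Uslice n.
  have bf := linear_bounded_functional cf.
  have /choice[F FP] : forall S, exists x, Z S -> [/\ Z x, `|x| <= 1,
      forall s t, `|s| <= M -> `|t| <= M ->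
        1 + `|(S - a) + W s t| - tilt n.+1 < `|x + ((S - a) + W s t)| &
      (exists s t, [/\ `|s| <= 1, `|t| <= 1 & U n (W s t)]) \/ U n (P x)].
    move=> S; have [ZS|] := pselect (Z S); last by exists 0.
    have [x xP] := slice_octahedral M bf e0 bA (ZB ZS Za) (tilt_gt0 n.+1).
    by exists x => _; rewrite UE.
  by exists F.
have /choice[F FP] := step.
pose S n := iteri n (fun m s => s + F m s) 0.
pose x n := F n (S n).
have SS n : S n.+1 = S n + x n by rewrite /S iteriS.
have ZS n : Z (S n).
  by elim: n => [//|n IH]; rewrite SS; apply: ZD => //; have [] := FP n _ IH.
have SE n : S n = \sum_(k < n) x k.
  elim: n => [|n IH]; first by rewrite big_ord0.
  by rewrite SS IH big_ord_recr.
have x1 n : `|x n| <= 1 by have [] := FP n _ (ZS n).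
have large n s t : `|s| <= M -> `|t| <= M ->
    `|W s t - a| + n%:R - 2^-1 + tilt n <= `|(S n - a) + W s t|.
  move=> sM tM; elim: n => [|n IH].
    by rewrite /S /tilt/= expr1 sub0r (addrC (- a)); lra.
  have [_ _ /(_ s t sM tM) h _] := FP n _ (ZS n).
  (* The errors [tilt n.+1] add up to [tilt 0 = 1/2]. *)
  have tE : tilt n = 2 * tilt n.+1 :> R.
    by rewrite /tilt [in RHS]exprS mulrA divff// mul1r.
  rewrite SS (_ : S n + x n - a + W s t = x n + (S n - a + W s t)); last first.
    by rewrite (addrC (S n)) -!addrA.
  by rewrite -natr1; move: h; rewrite -/(x n); lra.
have /choice[p pP] : forall n, exists q, U n q /\
    ((exists s t, [/\ `|s| <= 1, `|t| <= 1 & q = W s t]) \/ q = P (x n)).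
  move=> n; have [_ _ _ [[s [t [s1 t1 Ust]]]|Ux]] := FP n _ (ZS n).
    by exists (W s t); split=> //; left; exists s, t.
  by exists (P (x n)); split=> //; right.
have Aa : A a by apply: AP => //; rewrite da.
have pU n : range p `&` U n !=set0.
  by exists (p n); split; [exists n|exact: (pP n).1].
have /closureP aB := Udet (range p) pU a Aa.
have half0 : 0 < (2^-1 : R) by rewrite invr_gt0.
have [y hy ay] := aB _ half0.
(* [X] is only required to be nonnegative under every functional that is
   nonnegative on the [x k]: this is stable under convex combinations and spares
   explicit coefficients. *)
pose E : set Y := [set y | exists (N : nat) s t X, [/\ `|s| <= M, `|t| <= M, y = X + W s t &
  forall h, linear_functional h -> (forall k, (k < N)%N -> 0 <= h (x k)) -> 0 <= h X]].
have cE : convex_simple E.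
  move=> _ _ r r0 r1 [N1 [s1 [t1 [X1 [s1M t1M -> h1]]]]]
    [N2 [s2 [t2 [X2 [s2M t2M -> h2]]]]].
  have r1' : 0 <= 1 - r by lra.
  have box q1 q2 : `|q1| <= M -> `|q2| <= M -> `|r * q1 + (1 - r) * q2| <= M.
    move=> q1M q2M; rewrite (le_trans (ler_normD _ _))// !normrM.
    rewrite (ger0_norm r0) (ger0_norm r1').
    have := ler_wpM2l r0 q1M; have := ler_wpM2l r1' q2M; lra.
  exists (maxn N1 N2), (r * s1 + (1 - r) * s2), (r * t1 + (1 - r) * t2),
    (r *: X1 + (1 - r) *: X2); split; [exact: box|exact: box| |].
    rewrite (scalerDl u) (scalerDl v) !scalerDr !scalerA addrACA.
    by congr (_ + _); rewrite addrACA.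
  move=> h lh hx; rewrite lh.1 !lh.2 addr_ge0// mulr_ge0//.
    by apply: h1 => // k kN; apply: hx; rewrite leq_max kN.
  by apply: h2 => // k kN; apply: hx; rewrite leq_max kN orbT.
have BE : range p `<=` E.
  move=> _ [n _ <-]; case: (pP n).2 => [[s [t [s1 t1 ->]]]|->].
    exists 0%N, s, t, 0; rewrite add0r; split=> //; rewrite /M; [lra|lra|].
    by move=> h lh _; rewrite linear_functional0.
  exists n.+1, (- phi (x n)), (- psi (x n)), (x n); split.
  - by rewrite normrN (le_trans (fK _))// /M; have := ler_wpM2l (ltW K0) (x1 n); lra.
  - by rewrite normrN (le_trans (gL _))// /M; have := ler_wpM2l (ltW L0) (x1 n); lra.
  - by rewrite /plane_proj !scaleNr opprD.
  - by move=> h _; apply.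
have [N [s [t [X [sM tM yE hX]]]]] := conv_hull_min cE BE hy.
have [h [bh hle hN]] := norming_functional ((S N - a) + W s t).
have [lh _] := bh.
have hNE : h ((S N - a) + W s t) = \sum_(k < N) h (x k) + h (W s t - a).
  by rewrite -linear_functional_sum// -SE -lh.1 -addrA (addrC (- a)).
have := large N s t sM tM; rewrite -hN hNE => hlarge.
have tN := tilt_gt0 (R := R) N.
have hx1 k : h (x k) <= 1 by exact: le_trans (hle _) (x1 k).
have sumE : \sum_(k < N) (1 - h (x k)) = N%:R - \sum_(k < N) h (x k).
  by rewrite sumrB sumr_const card_ord.
have hpos k : (k < N)%N -> 0 <= h (x k).
  move=> kN; have : 1 - h (x k) <= \sum_(k < N) (1 - h (x k)).
    rewrite (bigD1 (Ordinal kN))//= lerDl sumr_ge0// => j _.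
    by rewrite subr_ge0.
  by rewrite sumE; have := hle (W s t - a); lra.
have hX0 := hX h lh hpos.
have : \sum_(k < N) h (x k) <= N%:R.
  by rewrite -subr_ge0 -sumE sumr_ge0// => j _; rewrite subr_ge0.
have : 1 <= `|W s t - a|.
  rewrite distrC -da; have := plane_dist_le_shift u v a (- s) (- t).
  by rewrite !scaleNr -opprD.
have := hle (y - a); rewrite distrC.
have -> : h (y - a) = h X + h (W s t - a) by rewrite yE -addrA lh.1.
lra.
Qed.

End NotSCD.

(** * Separable subspaces with the Daugavet property *)

Section SeparableSubspace.
Context {R : realType} {Y : normedModType R}.
Implicit Types (x y z a : Y).

Lemma conv_hull_finite (B : set Y) z : conv_hull B z ->
  exists2 s : seq Y, (forall x, x \in s -> B x) & conv_hull [set` s] z.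
Proof.
move: z; apply: conv_hull_min; last first.
  move=> x Bx; exists [:: x]; first by move=> y; rewrite inE => /eqP ->.
  by apply: sub_conv_hull; rewrite /= inE.
move=> x y t t0 t1 [s sB sx] [s' sB' sy]; exists (s ++ s').
  by move=> z; rewrite mem_cat => /orP[/sB|/sB'].
apply: conv_hull_convex => //.
- move: x sx; apply: conv_hull_min; first exact: conv_hull_convex.
  by move=> z zs; apply: sub_conv_hull; rewrite /= mem_cat zs.
- move: y sy; apply: conv_hull_min; first exact: conv_hull_convex.
  by move=> z zs; apply: sub_conv_hull; rewrite /= mem_cat zs orbT.
Qed.

Definition almost_additive (y : Y) (e : R) :=
  [set x : Y | `|x| <= 1 /\ 1 + `|y| - e < `|x + y|].

(** A point at distance [e] from the convex hull would be separated from it by a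
    functional, against the Daugavet property.  Finitely many points suffice
    because a convex combination only involves finitely many. *)
Lemma almost_additive_conv_hull a y (e : R) : daugavet_on (@setT Y) -> `|a| <= 1 -> 0 < e ->
  exists2 s : seq Y, (forall x, x \in s -> almost_additive y e x) &
    exists2 z, conv_hull [set` s] z & `|a - z| < e.
Proof.
move=> dY a1 e0.
suff [z /conv_hull_finite[s sf sz] az] :
    exists2 z, conv_hull (almost_additive y e) z & `|a - z| < e.
  by exists s => //; exists z.
apply: contrapT => h.
have cH := @conv_hull_convex _ _ (almost_additive y e).
have [z hz|f [bf _ fa]] := separation (a := a) cH e0.
  by rewrite leNgt; apply/negP => az; apply: h; exists z.
have [x [_ x1 fx xy]] := dY f a y e bf I a1 I e0.
have : f x <= f a - e by apply: fa; exact: sub_conv_hull.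
lra.
Qed.

Section Closure.
Variables (u v : Y) (s : Y -> Y -> nat -> seq Y).

(** The stages are finite lists, which makes their union enumerable outright;
    rational multiples instead of real ones keep them finite. *)
Fixpoint stage n : seq Y :=
  if n is n.+1 then
    stage n ++ [seq x + y | x <- stage n, y <- stage n]
    ++ [seq ratr (odflt 0 (unpickle i : option rat)) *: x | i <- iota 0 n, x <- stage n]
    ++ flatten [seq s x y n | x <- stage n, y <- stage n]
  else [:: 0; u; v].

Definition stages : set Y := [set x | exists n, x \in stage n].

Lemma stage_le m n : (m <= n)%N -> {subset stage m <= stage n}.
Proof.
elim: n => [|n IH]; first by rewrite leqn0 => /eqP ->.
rewrite leq_eqVlt => /predU1P[-> //|]; rewrite ltnS => /IH mn x /mn xn.
by rewrite /= mem_cat xn.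
Qed.

Lemma stagesD x y : stages x -> stages y -> stages (x + y).
Proof.
move=> [m xm] [n yn]; exists (maxn m n).+1; rewrite /= !mem_cat.
apply/orP; right; apply/orP; left; apply/allpairsP; exists (x, y) => /=.
by rewrite (stage_le (leq_maxl m n) xm) (stage_le (leq_maxr m n) yn).
Qed.

Lemma stagesZ (q : rat) x : stages x -> stages (ratr q *: x).
Proof.
have [i iq] : exists i, unpickle i = Some q by exists (pickle q); exact: pickleK.
move=> [m xm]; exists (maxn m i.+1).+1; rewrite /= !mem_cat.
apply/orP; right; apply/orP; right; apply/orP; left.
apply/allpairsP; exists (i, x) => /=.
rewrite mem_iota add0n leq_maxr/= iq; split=> //.
exact: stage_le (leq_maxl _ _) _ xm.
Qed.

Lemma stages_op x y N : stages x -> stages y ->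
  exists2 n, (N <= n)%N & forall z, z \in s x y n -> stages z.
Proof.
move=> [m xm] [k yk]; pose n := maxn N (maxn m k).
have mn : (m <= n)%N by rewrite /n; lia.
have kn : (k <= n)%N by rewrite /n; lia.
exists n; first exact: leq_maxl.
move=> z zs; exists n.+1; rewrite /= !mem_cat.
apply/orP; right; apply/orP; right; apply/orP; right.
apply/flattenP; exists (s x y n) => //; apply/allpairsP; exists (x, y) => /=.
by rewrite (stage_le mn xm) (stage_le kn yk).
Qed.

Lemma stages_enum : exists q : nat -> Y, (forall n, stages (q n)) /\
  forall x, stages x -> exists n, q n = x.
Proof.
exists (fun n => let p := odflt (0, 0)%N (unpickle n : option (nat * nat)) in
  nth 0 (stage p.1) p.2); split=> [n|x [n xn]].
  set p := odflt _ _; have [h|h] := ltnP p.2 (size (stage p.1)).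
    by exists p.1; exact: mem_nth.
  by exists 0%N; rewrite /= nth_default// inE eqxx.
by exists (pickle (n, index x (stage n))); rewrite pickleK/= nth_index.
Qed.

End Closure.

Definition closed_subspace (Z : set Y) := [/\ closed Z,
  forall x y, Z x -> Z y -> Z (x + y) & forall (r : R) x, Z x -> Z (r *: x)].

Definition dense_sequence (Z : set Y) (q : nat -> Y) := (forall n, Z (q n)) /\
  forall z (e : R), Z z -> 0 < e -> exists n, `|z - q n| < e.

Lemma ex_rat_near (r e : R) : 0 < e -> exists q : rat, r - e < ratr q < r.
Proof.
move=> e0; have [|q] := @rat_in_itvoo R (r - e) r; first by lra.
by rewrite in_itv /= => h; exists q.
Qed.

(** The union of the stages contains, with [a] and [y], a finite set of points
    almost norm-additive with [y] whose convex hull comes close to [a].  On such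
    a set a functional cannot stay below its value at [a], which gives the
    Daugavet property of the closure. *)
Lemma daugavet_separable_subspace u v : daugavet_on (@setT Y) ->
  exists Z q, [/\ closed_subspace Z, Z u, Z v, daugavet_on Z & dense_sequence Z q].
Proof.
move=> dY.
pose eps (n : nat) : R := n.+1%:R^-1.
have eps0 n : 0 < eps n by rewrite invr_gt0.
have /choice[s sP] : forall p : Y * Y * nat, exists s : seq Y, `|p.1.1| <= 1 ->
    (forall x, x \in s -> almost_additive p.1.2 (eps p.2) x) /\
    exists2 z, conv_hull [set` s] z & `|p.1.1 - z| < eps p.2.
  move=> [[a y] n] /=; have [a1|] := pselect (`|a| <= 1); last by exists [::].
  by have [s ? ?] := almost_additive_conv_hull y dY a1 (eps0 n); exists s.
pose Q := stages u v (fun a y n => s (a, y, n)).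
have [q [qQ Qq]] := stages_enum u v (fun a y n => s (a, y, n)).
pose Z := closure Q.
have QZ : Q `<=` Z by exact: subset_closure.
have Qinit x : x \in [:: 0; u; v] -> Q x by exists 0%N.
exists Z, q; split.
- split; first exact: closed_closure.
    move=> x y /closureP Zx /closureP Zy; apply/closureP => e e0.
    have e20 : 0 < e / 2 by lra.
    have [x' Qx' xx'] := Zx _ e20; have [y' Qy' yy'] := Zy _ e20.
    exists (x' + y'); first exact: stagesD.
    rewrite opprD addrACA (le_lt_trans (ler_normD _ _))//; lra.
  move=> r x /closureP Zx; apply/closureP => e e0.
  have h0 : 0 < 2 * (1 + `|r|) by have := normr_ge0 r; lra.
  have d0 := divr_gt0 e0 h0.
  have [x' Qx' xx'] := Zx _ d0.
  have k0 : 0 < 2 * (1 + `|x'|) by have := normr_ge0 x'; lra.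
  have d1 := divr_gt0 e0 k0.
  have [p /andP[p1 p2]] := ex_rat_near r d1.
  exists (ratr p *: x'); first exact: stagesZ.
  have -> : r *: x - ratr p *: x' = r *: (x - x') + (r - ratr p) *: x'.
    by rewrite scalerBr scalerBl addrA subrK.
  rewrite (le_lt_trans (ler_normD _ _))// !normrZ [`|r - _|]gtr0_norm ?subr_gt0//.
  have h1 : `|r| * `|x - x'| <= e / 2.
    have : (1 + `|r|) * `|x - x'| <= (1 + `|r|) * (e / (2 * (1 + `|r|))).
      by rewrite ler_wpM2l ?addr_ge0// ltW.
    rewrite (_ : (1 + `|r|) * (e / _) = e / 2); last by field; have := normr_ge0 r; lra.
    by have := normr_ge0 (x - x'); lra.
  have h2 : (r - ratr p) * (1 + `|x'|) < e / 2.
    have : (r - ratr p) * (1 + `|x'|) < e / (2 * (1 + `|x'|)) * (1 + `|x'|).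
      by rewrite ltr_pM2r; [lra|have := normr_ge0 x'; lra].
    by rewrite (_ : e / _ * _ = e / 2)//; field; have := normr_ge0 x'; lra.
  by lra.
- by apply: QZ; apply: Qinit; rewrite !inE eqxx /= orbT.
- by apply: QZ; apply: Qinit; rewrite !inE eqxx /= !orbT.
- move=> f a y e bf Za a1 Zy e0; have [lf [K K0 fK]] := bf.
  pose t := Num.min (2^-1) (Num.min (e / 4) (e / (8 * K))).
  have eK0 : 0 < e / (8 * K) by rewrite divr_gt0// mulr_gt0.
  have t0 : 0 < t by rewrite !lt_min eK0 invr_gt0 divr_gt0//= ltr0n.
  have t12 : t <= 2^-1 by rewrite ge_min lexx.
  have te : t <= e / 4 by rewrite !ge_min lexx orbT.
  have tK : t <= e / (8 * K) by rewrite !ge_min lexx !orbT.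
  have /closureP/(_ _ t0)[a' Qa' aa'] := Za.
  have /closureP/(_ _ t0)[y' Qy' yy'] := Zy.
  (* [a'] may leave the unit ball; a rational factor just below [1] brings it
     back while staying in the stages. *)
  have [p /andP[p1 p2]] := ex_rat_near (1 - t) t0.
  pose a2 := ratr p *: a'.
  have Qa2 : Q a2 by exact: stagesZ.
  have na' : `|a'| <= 1 + t.
    by have := ler_normB a (a - a'); rewrite opprB addrC subrK; lra.
  have pa : ratr p * `|a'| <= (1 - t) * (1 + t).
    by rewrite ler_pM//; lra.
  have tt : 0 <= t * t by rewrite mulr_ge0// ltW.
  have a21 : `|a2| <= 1.
    by rewrite normrZ ger0_norm; [lra|lra].
  have aa2 : `|a - a2| <= 3 * t + 2 * (t * t).
    have -> : a - a2 = (a - a') + (1 - ratr p) *: a'.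
      by rewrite scalerBl scale1r addrA subrK.
    rewrite (le_trans (ler_normD _ _))// normrZ ger0_norm; last lra.
    have : (1 - ratr p) * `|a'| <= (2 * t) * (1 + t) by rewrite ler_pM//; lra.
    lra.
  have tt1 : t * t <= t * 2^-1 by rewrite ler_wpM2l// ltW.
  have [n Nn sQ] := stages_op (Num.truncn t^-1) Qa2 Qy'.
  have nt : eps n <= t.
    rewrite /eps invf_ple ?posrE//; apply: ltW; apply: lt_le_trans (truncnS_gt _) _.
    by rewrite ler_nat ltnS.
  have [sfar [z sz a2z]] := sP (a2, y', n) a21.
  have az : `|a - z| < 6 * t.
    have := ler_normD (a - a2) (a2 - z); rewrite addrA subrK.
    by move: a2z => /=; lra.
  have Kaz : K * `|a - z| < e.
    have : K * `|a - z| < K * (6 * t) by rewrite ltr_pM2l.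
    have : K * t <= K * (e / (8 * K)) by rewrite ler_wpM2l// ltW.
    rewrite (_ : K * (e / _) = e / 8); last by field; rewrite gt_eqF.
    lra.
  have fz : f a - e < f z.
    have := le_trans (ler_norm _) (fK (a - z)); rewrite linear_functionalB//; lra.
  have [x [xs fx]] : exists x, x \in s (a2, y', n) /\ f a - e < f x.
    apply: contrapT => h.
    have : f z <= f a - e.
      move: z sz {a2z az Kaz fz}; apply: conv_hull_min.
        by apply: convex_sublevel => x1 x2 r _ _; rewrite lf.1 !lf.2.
      by move=> x /= xs; rewrite leNgt; apply/negP => fx; apply: h; exists x.
    lra.
  have [/= x1 xy'] := sfar x xs.
  exists x; split=> //; first by apply: QZ; exact: sQ.
  have := ler_normB (x + y) (y - y'); rewrite opprB addrACA subrr addr0.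
  have := ler_normD y' (y - y'); rewrite [y' + _]addrC subrK.
  lra.
- split=> [n|z e /closureP Zz e0]; first by apply: QZ; exact: qQ.
  by have [y /Qq[n <-] zy] := Zz _ e0; exists n.
Qed.

End SeparableSubspace.

(** * Existence of the data and conclusion *)

Section Bodies.
Context {R : realType} {Y : normedModType R}.
Implicit Types (x y z : Y) (Z : set Y).

Lemma separable_dense_sequence : separable_space Y ->
  exists q, dense_sequence (@setT Y) q.
Proof.
move=> [D /countable_injP[f fD] dD].
have /choice[q qP] : forall n, exists x, forall y, D y -> f y = n -> y = x.
  move=> n; have [[x [Dx fx]]|h] := pselect (exists x, D x /\ f x = n).
    by exists x => y Dy fy; apply: fD; rewrite ?inE// fy.
  by exists 0 => y Dy fy; case: h; exists y.
exists q; split=> // z e _ e0.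
have [|x [zx Dx]] := dD (ball z e) _ (ball_open z e).
  by exists z; exact: ballxx.
by exists (f x); rewrite -(qP _ x Dx erefl); move: zx; rewrite -ball_normE.
Qed.

(** A point of the ball almost norm-additive with [- u] on which [phi] is large
    cannot be a multiple of [u], so it provides the second direction. *)
Lemma ex_biorthogonal : (exists y : Y, y != 0) -> daugavet_on (@setT Y) ->
  exists u v phi psi, biorthogonal (u : Y) v phi psi.
Proof.
move=> [y0 y0n0] dY; have [u u1 _] := ex_unit_vector y0n0.
have [phi [bphi phi1 phiu]] := norming_functional u; rewrite u1 in phiu.
have u1' : `|u| <= 1 by rewrite u1.
have half0 : 0 < (2^-1 : R) by rewrite invr_gt0.
have [x [_ x1 phix xu]] := dY phi u (- u) 2^-1 bphi I u1' I half0.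
pose v := x - phi x *: u.
have phiv : phi v = 0.
  by rewrite /v (linear_functionalB _ _ bphi.1) bphi.1.2 phiu mulr1 subrr.
have vn0 : v != 0.
  apply/eqP => v0; have xE : x = phi x *: u.
    by rewrite -[LHS](subrK (phi x *: u)) -/v v0 add0r.
  move: xu; rewrite normrN u1 xE -{2}(scale1r u) -scalerBl normrZ u1 mulr1.
  by have px := phi1 x; rewrite ler0_norm; lra.
have nv : `|v| != 0 by rewrite normr_eq0.
have [h [bh _ hv]] := norming_functional v.
exists u, v, phi, (fun y => `|v|^-1 * h y + (- (`|v|^-1 * h u)) * phi y); split=> //.
- exact: bounded_functional_comb.
- by rewrite phiu hv phiv mulVf//; split; ring.
Qed.

Lemma ex_logn2 k N : exists2 n, (N <= n)%N & k = logn 2 n.+1.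
Proof.
have pos : (0 < 2 ^ k * (2 * N + 1))%N by rewrite muln_gt0 expn_gt0 addn1.
have lt : (N < 2 * N + 1)%N by lia.
exists (2 ^ k * (2 * N + 1)).-1.
  by rewrite -ltnS prednK// (leq_trans lt)// leq_pmull// expn_gt0.
rewrite prednK// lognM ?expn_gt0 ?addn1// pfactorK// logn_coprime ?addn0//.
by rewrite coprime2n /= mul2n odd_double.
Qed.

(** Normalized projections of a dense sequence.  A point at positive distance
    from the plane exists because some [x] is almost norm-additive with a large
    box of the plane; outside the box the coordinates bound the norm from
    below. *)
Lemma ex_dense_sphere Z q u v phi psi : closed_subspace Z -> Z u -> Z v ->
  daugavet_on Z -> dense_sequence Z q -> biorthogonal u v phi psi ->
  exists b, dense_sphere Z u v phi psi b.
Proof.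
move=> [_ ZD ZZ] Zu Zv dZ [qZ qd] biorth.
have [bphi bpsi _ _] := biorth.
have Z0 : Z 0 by rewrite -(scale0r u); exact: ZZ.
have ZP x : Z x -> Z (plane_proj u v phi psi x).
  move=> Zx; rewrite /plane_proj -scaleN1r.
  by apply: (ZD) => //; apply: (ZZ); apply: ZD; exact: ZZ.
pose d := plane_dist u v.
have normal x : Z x -> 0 < d x -> exists z, [/\ Z z, phi z = 0, psi z = 0, d z = 1 &
    z = (d x)^-1 *: plane_proj u v phi psi x].
  move=> Zx dx0; exists ((d x)^-1 *: plane_proj u v phi psi x).
  split=> //; first exact/ZZ/ZP.
  - by rewrite bphi.1.2 (phi_proj biorth) mulr0.
  - by rewrite bpsi.1.2 (psi_proj biorth) mulr0.
  - by rewrite /d plane_distZ plane_dist_proj// gtr0_norm ?invr_gt0// mulVf ?gt_eqF.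
have [x0 Zx0 dx0] : exists2 x, Z x & 0 < d x.
  have [[lp [K K0 fK]] [lq [L L0 gL]]] := (bphi, bpsi).
  have half0 : 0 < (2^-1 : R) by rewrite invr_gt0.
  have z1 : `|0 : Y| <= 1 by rewrite normr0.
  have b0 := bounded_functional_comb 0 0 bphi bphi.
  have [x [Zx x1 _ hx]] := octahedral_box ZD dZ Zu Zv ZZ (2 * (K + L)) b0 Z0 z1 Z0 half0.
  exists x => //.
  have away s t : 2^-1 <= `|x + (s *: u + t *: v)|.
    have [sM|sM] := leP `|s| (2 * (K + L)); last first.
      have := fK (x + (s *: u + t *: v)); have := fK x.
      rewrite lp.1 (phi_plane biorth).
      have := ler_normB (phi x + s) (phi x); rewrite addrC addKr => h1 h2 h3.
      have := ler_wpM2l (ltW K0) x1 => h4.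
      rewrite -(ler_pM2l K0); lra.
    have [tM|tM] := leP `|t| (2 * (K + L)); last first.
      have := gL (x + (s *: u + t *: v)); have := gL x.
      rewrite lq.1 (psi_plane biorth).
      have := ler_normB (psi x + t) (psi x); rewrite addrC addKr => h1 h2 h3.
      have := ler_wpM2l (ltW L0) x1 => h4.
      rewrite -(ler_pM2l L0); lra.
    have := hx s t sM tM; rewrite !add0r.
    by have := normr_ge0 (s *: u + t *: v); lra.
  have q0 : 0 < (4^-1 : R) by rewrite invr_gt0.
  have [s [t hst]] := plane_dist_adherent u v x q0.
  by have := away s t; rewrite -/(d x) in hst; lra.
have [z0 [Zz0 z01 z02 dz0 _]] := normal _ Zx0 dx0.
have /choice[c cP] : forall k, exists z, [/\ Z z, phi z = 0, psi z = 0, d z = 1 &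
    0 < d (q k) -> z = (d (q k))^-1 *: plane_proj u v phi psi (q k)].
  move=> k; have [dk|dk] := ltP 0 (d (q k)).
    by have [z [? ? ? ? zE]] := normal _ (qZ k) dk; exists z.
  by exists z0; split.
(* The map [logn 2 n.+1] takes every value at arbitrarily large indices. *)
exists (fun n => c (logn 2 n.+1)); split=> [n|z e N Zz z1 z2 dz e0].
  by have [] := cP (logn 2 n.+1).
have [K K0 PK] := proj_bounded biorth.
have [L L0 dL] := norm_le_plane_dist biorth.
pose t := Num.min (2^-1) (e / (2 * (K + L))).
have KL0 : 0 < K + L by rewrite addr_gt0.
have tKL : 0 < e / (2 * (K + L)) by rewrite divr_gt0// mulr_gt0.
have t0 : 0 < t by rewrite lt_min tKL invr_gt0/= ltr0n.
have t12 : t <= 2^-1 by rewrite ge_min lexx.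
have te : t <= e / (2 * (K + L)) by rewrite ge_min lexx orbT.
have [k hk] := qd z t Zz t0.
have dk1 : d z <= d (q k) + `|z - q k| := plane_dist_lipschitz u v z (q k).
have dk2 := plane_dist_lipschitz u v (q k) z.
rewrite distrC -/(d (q k)) -/(d z) in dk2.
have dqk : 0 < d (q k) by lra.
have [n Nn kn] := ex_logn2 k N; exists n => //; rewrite -kn.
have [_ _ _ _ /(_ dqk) ckE] := cP k.
pose w := plane_proj u v phi psi (q k).
have zw : `|z - w| <= K * `|z - q k|.
  have zE : z = plane_proj u v phi psi z by rewrite proj_id.
  have -> : z - w = plane_proj u v phi psi (z - q k).
    by rewrite (proj_linearD biorth) -zE -(scaleN1r (q k)) (proj_linearZ biorth) scaleN1r.
  exact: PK.
have wL : `|w| <= L * d (q k).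
  by have := dL w (phi_proj biorth _) (psi_proj biorth _); rewrite /w plane_dist_proj.
have wc : `|w - c k| <= L * `|z - q k|.
  have -> : w - c k = ((d (q k) - 1) / d (q k)) *: w.
    by rewrite ckE mulrBl divff ?gt_eqF// scalerBl scale1r mul1r.
  rewrite normrZ normrM normfV (gtr0_norm dqk) mulrAC ler_pdivrMr//.
  have : `|d (q k) - 1| <= `|z - q k| by rewrite ler_norml; lra.
  move=> h; rewrite mulrAC mulrC.
  by apply: le_trans (ler_pM _ _ wL h) _ => //; rewrite mulrAC.
have := ler_normD (z - w) (w - c k); rewrite addrA subrK.
have : (K + L) * `|z - q k| < (K + L) * (e / (2 * (K + L))).
  by rewrite ltr_pM2l//; lra.
rewrite (_ : (K + L) * (e / _) = e / 2); last by field; rewrite gt_eqF.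
lra.
Qed.

Lemma ex_tilted_bodies Z q u v phi psi : closed_subspace Z -> Z u -> Z v ->
  daugavet_on Z -> dense_sequence Z q -> biorthogonal u v phi psi ->
  exists C1 C2 : set Y,
    [/\ [/\ convex_set C1, closed C1, bounded_set C1 & symmetric_set C1],
        [/\ convex_set C2, closed C2, bounded_set C2 & symmetric_set C2],
        (forall x, Z x) -> C1° !=set0 /\ C2° !=set0,
        SCD C1 /\ SCD C2 & ~ SCD (C1 `&` C2)].
Proof.
move=> sZ Zu Zv dZ qZ biorth; have [cZ ZD ZZ] := sZ.
have [b bP] := ex_dense_sphere sZ Zu Zv dZ qZ biorth.
have biorth' := biorthogonalC biorth.
have bP' : dense_sphere Z v u psi phi b.
  split=> [n|z e N Zz z1 z2]; first by rewrite plane_distC; have [] := bP.1 n.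
  by rewrite plane_distC => dz; exact: bP.2.
exists (tilted_body u v b), (tilted_body v u b); split.
- split; [exact/convex_setP/tilted_body_convex|exact: closed_hull| |].
    exact: (tilted_body_bounded biorth bP).
  exact: tilted_body_symmetric.
- split; [exact/convex_setP/tilted_body_convex|exact: closed_hull| |].
    exact: (tilted_body_bounded biorth' bP').
  exact: tilted_body_symmetric.
- move=> ZT; split.
    exact: (tilted_body_interior biorth bP ZZ ZT).
  exact: (tilted_body_interior biorth' bP' ZZ ZT).
- split; first exact: (tilted_body_SCD biorth bP).
  exact: (tilted_body_SCD biorth' bP').
have [Za a1 a2 da] := bP.1 0%N.
apply: (not_SCD biorth dZ Zu Zv ZD ZZ _ _ _ _ _ Za a1 a2 da).
- by move=> x [/(tilted_body_sub bP Zu Zv cZ ZD ZZ)].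
- by move=> x [_ /(tilted_body_le biorth' bP')]; rewrite plane_distC.
- by move=> x [/(tilted_body_le biorth bP)].
- move=> s t s1 t1; split; first exact: tilted_body_square.
  by rewrite addrC; exact: tilted_body_square.
- move=> z Zz z1 z2 dz; split; first exact: (tilted_body_ball biorth bP).
  by apply: (tilted_body_ball biorth' bP') => //; rewrite plane_distC.
Qed.

End Bodies.

Theorem theorem3p8 (R : realType) (Y : completeNormedModType R)
    (Y_neq0 : exists y : Y, y != 0) (Y_daugavet : daugavet_property Y) :
  (exists C1 C2 : set Y,
    [/\ [/\ convex_set C1, closed C1, bounded_set C1 & symmetric_set C1],
        [/\ convex_set C2, closed C2, bounded_set C2 & symmetric_set C2],
        SCD C1, SCD C2 & ~ SCD (C1 `&` C2)])
  /\
  (separable_space Y ->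
   exists C1 C2 : set Y,
    [/\ [/\ convex_set C1, closed C1, bounded_set C1 & symmetric_set C1],
        [/\ convex_set C2, closed C2, bounded_set C2 & symmetric_set C2],
        C1° !=set0 /\ C2° !=set0,
        SCD C1 /\ SCD C2 & ~ SCD (C1 `&` C2)]).
Proof.
have dY := daugavet_on_setT Y_neq0 Y_daugavet.
have [u [v [phi [psi biorth]]]] := ex_biorthogonal Y_neq0 dY.
split=> [|/separable_dense_sequence[q qT]].
  have [Z [q [sZ Zu Zv dZ qZ]]] := daugavet_separable_subspace u v dY.
  have [C1 [C2 [P1 P2 _ [S1 S2] nS]]] := ex_tilted_bodies sZ Zu Zv dZ qZ biorth.
  by exists C1, C2.
have sT : closed_subspace (@setT Y) by split=> //; exact: closedT.
have [C1 [C2 [P1 P2 int S nS]]] := ex_tilted_bodies sT I I dY qT biorth.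
by exists C1, C2; split=> //; exact: int.
Qed.
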